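(* Let $\phi$ be a Legendre dgf on $\mathbb R^n$, $X=\operatorname{dom}\phi$, $Y=\operatorname{int}\operatorname{dom}\phi$, $X_*=\operatorname{dom}\phi^*$, $Y_*=\operatorname{int}\operatorname{dom}\phi^*$, and let $f:X\to\overline{\mathbb R}$ be proper, lsc, and $\phi$-prox-bounded with threshold $\lambda_f$. For $\lambda\in(0,\lambda_f)$ denote $h_\lambda=\overleftarrow{\mathrm{env}}_\lambda f\circ\nabla\phi^*:Y_*\to\overline{\mathbb R}$. Then, for any $\lambda\in(0,\lambda_f)$ the following are equivalent: (a) $h_\lambda$ is proper and convex. (b) $\lambda h_\lambda$ is convex and $\mathrm B_{\phi^*}$-smooth. (c) $(\lambda\tilde f+\phi)^*|_{X_*}$ is $\mathrm B_{\phi^*}$-smooth. (d) $h_\lambda$ is convex and continuously differentiable. Under any of these conditions, one has $\nabla h_\lambda=\lambda^{-1}\bigl(\nabla\phi^*-\overleftarrow{\mathrm{prox}}_{\lambda f}\circ\nabla\phi^*\bigr)$, and in particular $\overleftarrow{\mathrm{prox}}_{\lambda f}$ is single-valued; moreover the following conditions also hold: (e) $\overleftarrow{\mathrm{prox}}_{\lambda f}$ is $\mathrm a_\phi$-firmly nonexpansive. (f) $\operatorname{dom}\overleftarrow{\mathrm{prox}}_{\lambda f}=Y$, and $\langle x_1-x_2,\nabla\phi(y_1)-\nabla\phi(y_2)\rangle\le D_\phi^{\mathrm{sym}}(y_1,y_2)$ for all $y_i\in Y$ and $x_i\in\overleftarrow{\mathrm{prox}}_{\lambda f}(y_i)$,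 $i=1,2$. When $\phi$ is 1-coercive, all the statements (a)–(f) are equivalent and entail $\mathrm B_\phi$-weak convexity of $\lambda f$.
   Context: $\overline{\mathbb R}=[-\infty,\infty]$. A distance-generating function (dgf) is a proper, lsc, convex $\phi:\mathbb R^n\to\overline{\mathbb R}$ differentiable on $\operatorname{int}\operatorname{dom}\phi\neq\emptyset$. $\phi^*$ is its convex conjugate. $D_\phi(x,y)=\phi(x)-\phi(y)-\langle\nabla\phi(y),x-y\rangle$ if $y\in Y$, and $\infty$ otherwise; $D_\phi^{\mathrm{sym}}(x,y)=D_\phi(x,y)+D_\phi(y,x)$. $\phi$ is Legendre if it is essentially smooth (differentiable on $Y\ne\emptyset$ with $\|\nabla\phi(x^k)\|\to\infty$ whenever $Y\ni x^k\to x\in\operatorname{bdry}\operatorname{dom}\phi$) and essentially strictly convex (strictly convex on every convex subset of $\operatorname{dom}\partial\phi$); then $\nabla\phi:Y\to Y_*$ is a bijection with inverse $\nabla\phi^*$. $\phi$ is 1-coercive if $\liminf_{\|x\|\to\infty}\phi(x)/\|x\|=\infty$. A function is proper if not identically $\infty$ and never $-\infty$; lsc for $f:X\to\overline{\mathbb R}$ is meant relative to $X$. $\tilde f:\mathbb R^n\to\overline{\mathbb R}$ equals $f$ on $X$ and $\infty$ elsewhere. For $\bar y\in Y$, $\overleftarrow{\mathrm{prox}}_{\lambda f}(\bar y)=\operatorname{argmin}_{x\in X}\{f(x)+\frac1\lambda D_\phi(x,\bar y)\}$, and $\overleftarrow{\mathrm{env}}_\lambda f(\bar y)$ is the corresponding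 infimum. $f$ is $\phi$-prox-bounded if $\overleftarrow{\mathrm{env}}_\lambda f(y)>-\infty$ for some $\lambda>0$, $y\in Y$; $\lambda_f$ is the supremum of all such $\lambda$. $\operatorname{dom}T=\{y:T(y)\ne\emptyset\}$. $h:X\to\overline{\mathbb R}$ is $\mathrm B_\phi$-weakly convex if $h+\phi$ is convex on $\operatorname{int}X$. A function $h$ defined on $X_*$, or only on $Y_*$, is $\mathrm B_{\phi^*}$-smooth if both $h+\phi^*$ and $-h+\phi^*$ are convex on $Y_*$, it being understood that $h$ is finite-valued on $Y_*$. A single-valued $T:Y\to X$ is $\mathrm a_\phi$-firmly nonexpansive if $\phi(\bar y)+\phi(y)\ge\phi(\bar y-T\bar y+Ty)+\phi(y-Ty+T\bar y)$ for all $\bar y,y\in Y$. *)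

(* Defs.v *)
From HB Require Import structures.
From mathcomp Require Import all_boot all_order all_algebra.
From mathcomp Require Import all_classical all_reals all_analysis.

Set Implicit Arguments.
Unset Strict Implicit.
Unset Printing Implicit Defensive.

Import Order.TTheory GRing.Theory Num.Theory.
Import numFieldNormedType.Exports.

Local Open Scope classical_set_scope.
Local Open Scope ring_scope.
Local Open Scope ereal_scope.

(* A function "defined on A" (A a subset of R^n) with values in [-oo, +oo] is
   encoded as a total function 'rV[R]_n -> \bar R whose values off A are never
   used: every notion below that is relative to a set takes this set as an
   argument. *)

Section Definitions.
Context {R : realType} {n : nat}.
Local Notation V := 'rV[R]_n.
Implicit Types (f g h phi : V -> \bar R) (A : set V) (x y v : V).

Definition dot x y : R := (\sum_(i < n) x ord0 i * y ord0 i)%R.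

(* The library norm on 'rV[R]_n is the sup norm; this is the Euclidean one. *)
Definition enorm x : R := Num.sqrt (dot x x).

Definition edom f : set V := [set x | f x < +oo].

Definition intdom f : set V := (edom f)°.

Definition proper_on A f : Prop :=
  (exists2 x, A x & f x != +oo) /\ (forall x, A x -> f x != -oo).

(* Relative version of [lower_semicontinuous]. *)
Definition lsc_on A f : Prop := forall x a, A x -> a%:E < f x ->
  \forall y \near within A (nbhs x), a%:E < f y.

Definition epigraph_on A f : set (V * R^o) :=
  [set p | A p.1 /\ f p.1 <= (p.2)%:E].

Definition convex_on A f : Prop := convex_set (epigraph_on A f).

Definition differentiable_at f x : Prop :=
  (\forall y \near x, f y \is a fin_num) /\ differentiable (fine \o f) x.

(* Junk value when f is not differentiable at x. *)
Definition grad f x : V := (\row_(i < n) 'd (fine \o f) x (delta_mx ord0 i))%R.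

(* Intended for A open. *)
Definition C1_on A f : Prop :=
  (forall x, A x -> differentiable_at f x) /\ {within A, continuous (grad f)}.

Definition conjugate f v : \bar R :=
  ereal_sup [set (dot v x)%:E - f x | x in [set: V]].

Definition subdiff f x : set V :=
  [set v | forall z, f x + (dot v (z - x)%R)%:E <= f z].

Definition set_dom (T : V -> set V) : set V := [set y | T y !=set0].

Definition single_valued_on A (S : V -> set V) (T : V -> V) : Prop :=
  forall y, A y -> S y = [set T y].

Definition dgf phi : Prop :=
  [/\ proper_on setT phi, lower_semicontinuous phi, convex_on setT phi,
      intdom phi !=set0 &
      forall y, intdom phi y -> differentiable_at phi y].

Definition essentially_smooth phi : Prop :=
  [/\ intdom phi !=set0,
      forall y, intdom phi y -> differentiable_at phi y &
      forall (x : nat -> V) (xbar : V),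
        (forall k, intdom phi (x k)) -> x @ \oo --> xbar ->
        (closure (edom phi) `\` intdom phi) xbar ->
        (fun k => enorm (grad phi (x k))) @ \oo --> +oo%R].

Definition strictly_convex_on A f : Prop :=
  forall x y (t : R), A x -> A y -> x != y -> (0 < t < 1)%R ->
    f (t *: x + (1 - t) *: y)%R < t%:E * f x + (1 - t)%:E * f y.

Definition essentially_strictly_convex phi : Prop :=
  forall C : set V, C `<=` set_dom (subdiff phi) -> convex_set C ->
    strictly_convex_on C phi.

Definition legendre phi : Prop :=
  essentially_smooth phi /\ essentially_strictly_convex phi.

(* The filter of neighbourhoods of "||x|| -> oo". *)
Definition norm_infty : set_system V :=
  [set U | \forall r \near +oo%R, forall x, (r < enorm x)%R -> U x].

Definition one_coercive phi : Prop :=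
  limf_einf (fun x => phi x * (enorm x)^-1%:E) norm_infty = +oo.

Definition bregman phi x y : \bar R :=
  if y \in intdom phi then phi x - phi y - (dot (grad phi y) (x - y)%R)%:E
  else +oo.

Definition bregman_sym phi x y : \bar R := bregman phi x y + bregman phi y x.

Definition env phi (lambda : R) f y : \bar R :=
  ereal_inf [set f x + (lambda^-1)%:E * bregman phi x y | x in edom phi].

(* A set-valued map on int dom phi, extended by the empty set. *)
Definition prox phi (lambda : R) f y : set V :=
  [set x | [/\ intdom phi y, edom phi x &
    forall z, edom phi z ->
      f x + (lambda^-1)%:E * bregman phi x y <=
      f z + (lambda^-1)%:E * bregman phi z y]].

Definition prox_bounding phi f : set R :=
  [set lambda | (0 < lambda)%R /\
     exists2 y, intdom phi y & -oo < env phi lambda f y].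

Definition prox_bounded phi f : Prop := prox_bounding phi f !=set0.

Definition prox_threshold phi f : \bar R :=
  ereal_sup [set lambda%:E | lambda in prox_bounding phi f].

Definition B_weakly_convex phi h : Prop :=
  convex_on (intdom phi) (fun x => h x + phi x).

(* To be used with phi := conjugate _ for B_{phi^*}-smoothness. *)
Definition B_smooth phi h : Prop :=
  [/\ forall y, intdom phi y -> h y \is a fin_num,
      convex_on (intdom phi) (fun y => h y + phi y) &
      convex_on (intdom phi) (fun y => - h y + phi y)].

Definition a_firmly_nonexpansive phi (T : V -> V) : Prop :=
  (forall y, intdom phi y -> edom phi (T y)) /\
  forall ybar y, intdom phi ybar -> intdom phi y ->
    phi (ybar - T ybar + T y)%R + phi (y - T y + T ybar)%R <=
    phi ybar + phi y.

End Definitions.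

(* Main.v *)
Require Import Defs.
From HB Require Import structures.
From mathcomp Require Import all_boot all_order all_algebra.
From mathcomp Require Import all_classical all_reals all_analysis.
From mathcomp Require Import ring lra.

(** The map [grad phis] identifies the slopes in [Ys = intdom (conjugate phi)]
    with the points of [Y = intdom phi]. In these coordinates the proximal
    problem at [y = grad phis eta] is the minimization of [g - <eta, .>] with
    [g = lambda f + phi], extended by [+oo] ([prox_criterionE]). Hence
    [prox phi lambda f y] is the set of points at which [eta] is a subgradient
    of [g] ([proxP]), and
      [lambda h = conjugate phi - conjugate g] on [Ys] ([envE]).
    As conjugates are always convex, (a), (b) and (c) all say that [conjugate g]
    is finite on [Ys] and that the difference [psi] of the two conjugates is
    convex there ([gap_convex]).

    The analytic content is that convexity of [psi] forces differentiability.
    The function [g] is lower semicontinuous and coercive against every interior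
    slope, so that a minimizer [x] exists ([touch_exists]); since [x] is a
    subgradient of [conjugate g], the increments of [psi] at [eta] are bounded
    above by those of [conjugate phi] minus a linear term, up to [o]. A convex
    function below such a bound is differentiable, with gradient
    [grad phis eta - x] ([gap_has_grad]). This gives uniqueness of [x], the
    formula for the gradient of [h], and, since unique minimizers depend
    continuously on the slope ([sharp_near]), (d).

    For (e), [psi] and [conjugate g] lie above their tangents; choosing the
    tangents at two different slopes and conjugating back bounds
    [phi (y - T y + T ybar)], and exchanging the two points and adding cancels
    the constants ([gap_exchange]). (f) follows by bounding the smaller side
    of (e) below by tangents of [phi]. From (f) back to convexity: the selection
    [grad phis eta - x] is monotone, and one-sided increments of [psi] along a
    fine partition of a segment add up to the tangent inequality because the
    errors telescope ([gap_steps]).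

    When [phi] is 1-coercive, [Ys] is the whole space and [g] coincides with its
    biconjugate: for each [w] and [e], minimizing [conjugate g] plus a quadratic
    gives a slope [eta] with [w = x + e eta], where [x] is the gradient of
    [conjugate g] at [eta] and therefore a point where [g] touches its tangent
    of slope [eta]; letting [e] vanish, [le_of_resolvents] recovers [g w]. The
    same device applied to [phi] yields the form of the Fenchel-Moreau theorem
    that (e) needs ([conjugate_dual_le]).

    Legendre duality between [Y] and [Ys] rests on two facts. By essential
    smoothness no boundary point of the domain carries a subgradient
    ([touch_intdom]); by strict convexity a subgradient determines its point, and
    then the gap between [phi] and its tangent grows linearly away from the point
    ([convex_unique_touch_sharp]), which puts the slope in the interior of the
    domain of the conjugate and makes the conjugate differentiable there. *)

Set Implicit Arguments.
Unset Strict Implicit.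
Unset Printing Implicit Defensive.

Import Order.TTheory GRing.Theory Num.Theory.
Import numFieldNormedType.Exports.

Local Open Scope classical_set_scope.
Local Open Scope ring_scope.
Local Open Scope ereal_scope.

(** * Euclidean inner product and sup norm *)

Section Euclidean.
Context {R : realType} {n : nat}.
Local Notation V := 'rV[R]_n.
Implicit Types (x y z u v w : V).

Lemma dotC x y : dot x y = dot y x.
Proof. by apply: eq_bigr => i _; rewrite mulrC. Qed.

Lemma dotDl x y z : dot (x + y) z = (dot x z + dot y z)%R.
Proof.
by rewrite /dot -big_split /=; apply: eq_bigr => i _; rewrite mxE mulrDl.
Qed.

Lemma dotZl (a : R) x y : dot (a *: x) y = (a * dot x y)%R.
Proof. by rewrite /dot mulr_sumr; apply: eq_bigr => i _; rewrite mxE mulrA. Qed.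

Lemma dotNl x y : dot (- x) y = (- dot x y)%R.
Proof. by rewrite -scaleN1r dotZl mulN1r. Qed.

Lemma dotBl x y z : dot (x - y) z = (dot x z - dot y z)%R.
Proof. by rewrite dotDl dotNl. Qed.

Lemma dotDr x y z : dot x (y + z) = (dot x y + dot x z)%R.
Proof. by rewrite !(dotC x) dotDl. Qed.

Lemma dotZr (a : R) x y : dot x (a *: y) = (a * dot x y)%R.
Proof. by rewrite !(dotC x) dotZl. Qed.

Lemma dotNr x y : dot x (- y) = (- dot x y)%R.
Proof. by rewrite !(dotC x) dotNl. Qed.

Lemma dotBr x y z : dot x (y - z) = (dot x y - dot x z)%R.
Proof. by rewrite !(dotC x) dotBl. Qed.

Lemma dot0l x : dot 0 x = 0%R.
Proof. by rewrite -(scale0r (0 : V)) dotZl mul0r. Qed.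

Lemma dot0r x : dot x 0 = 0%R.
Proof. by rewrite dotC dot0l. Qed.

Definition dotE :=
  (dotDl, dotDr, dotBl, dotBr, dotZl, dotZr, dotNl, dotNr, dot0l, dot0r).

Lemma dot_delta x i : dot x (delta_mx ord0 i) = x ord0 i.
Proof.
rewrite /dot (bigD1 i) //= mxE !eqxx mulr1 big1 ?addr0 // => j ji.
by rewrite mxE eqxx (negbTE ji) mulr0.
Qed.

Lemma coord_le_norm x i : (`|x ord0 i| <= `|x|)%R.
Proof.
rewrite [leRHS]/Num.norm /= mx_normrE.
by apply/bigmax_geP; right => /=; exists (ord0, i).
Qed.

Lemma norm_leP x (a : R) : (0 <= a)%R ->
  (forall i, (`|x ord0 i| <= a)%R) -> (`|x| <= a)%R.
Proof.
move=> a0 xa; rewrite [leLHS]/Num.norm /= mx_normrE.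
by apply/bigmax_leP; split => // -[i j] _ /=; rewrite ord1; exact: xa.
Qed.

Lemma dot_le x y : (`|dot x y| <= n%:R * `|x| * `|y|)%R.
Proof.
apply: (le_trans (ler_norm_sum _ _ _)).
apply: (@le_trans _ _ (\sum_(i < n) `|x| * `|y|)%R).
  by apply: ler_sum => i _; rewrite normrM ler_pM // coord_le_norm.
by rewrite sumr_const card_ord -mulrA mulr_natl.
Qed.

Lemma dotvv_ge0 x : (0 <= dot x x)%R.
Proof. by apply: sumr_ge0 => i _; rewrite -expr2 sqr_ge0. Qed.

Lemma sqr_norm_le_dot x : (`|x| ^+ 2 <= dot x x)%R.
Proof.
have d0 := dotvv_ge0 x.
suff xd : (`|x| <= Num.sqrt (dot x x))%R.
  rewrite -[leRHS](sqr_sqrtr d0) ler_pXn2r // nnegrE // sqrtr_ge0.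
apply: norm_leP; first exact: sqrtr_ge0.
move=> i; rewrite -sqrtr_sqr ler_wsqrtr // /dot (bigD1 i) //= expr2.
by rewrite lerDl sumr_ge0 // => j _; rewrite -expr2 sqr_ge0.
Qed.

Lemma dotvv_eq0 x : dot x x = 0%R -> x = 0%R.
Proof.
move=> x0; have := sqr_norm_le_dot x; rewrite x0 => h.
have : (`|x| ^+ 2 == 0)%R by rewrite eq_le h sqr_ge0.
by rewrite expf_eq0 /= normr_eq0 => /eqP.
Qed.

Lemma norm_le_enorm x : (`|x| <= enorm x)%R.
Proof.
by rewrite -[leLHS]ger0_norm // -sqrtr_sqr ler_wsqrtr // sqr_norm_le_dot.
Qed.

Lemma enorm_le_norm x : (enorm x <= n.+1%:R * `|x|)%R.
Proof.
rewrite -[leRHS]ger0_norm ?mulr_ge0 // -sqrtr_sqr ler_wsqrtr //.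
apply: (le_trans (ler_norm _)); apply: (le_trans (dot_le x x)).
rewrite -mulrA -expr2 exprMn ler_wpM2r ?sqr_ge0 // expr2.
by rewrite -natrM ler_nat (leq_trans (leqnSn n)) // leq_pmulr.
Qed.

Lemma dot_continuous v : continuous (dot v : V -> R).
Proof.
move=> x; apply/(@cvgrPdist_le _ _ _ (nbhs x)) => e e0.
have c0 : (0 < n.+1%:R * (`|v| + 1) :> R)%R by rewrite mulr_gt0 // ltr_wpDl.
have := @nbhsx_ballx _ _ x _ (divr_gt0 e0 c0).
apply: filterS => z; rewrite -ball_normE /= => xz.
rewrite -dotBr (le_trans (dot_le _ _)) //.
have : (n%:R * `|v| * `|x - z| <= (n.+1%:R * (`|v| + 1)) * `|x - z|)%R.
  by rewrite ler_wpM2r // ler_pM // ?ler_nat // lerDl.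
move=> h; apply: (le_trans h); rewrite mulrC -ler_pdivlMr //.
exact: ltW.
Qed.

End Euclidean.

(** * Gradients *)

Section Gradients.
Context {R : realType} {n : nat}.
Local Notation V := 'rV[R]_n.
Implicit Types (F G : V -> R) (f : V -> \bar R) (x z u v w : V).

(** Frechet differentiability with gradient [v], in the form of an estimate that
    can be derived from, and turned into, inequalities between values of [F]. *)
Definition has_grad F x v := forall e : R, (0 < e)%R ->
  \forall z \near x, (`|F z - F x - dot v (z - x)| <= e * `|z - x|)%R.

Lemma near_along x u (P : set V) : nbhs x P ->
  exists2 t : R, (0 < t < 1)%R & P (x + t *: u)%R.
Proof.
move=> /nbhs_ballP[r /= r0 rP].
have c0 : (0 < 2 * (`|u| + 1) :> R)%R by rewrite mulr_gt0 // ltr_wpDl.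
exists (Num.min (2^-1)%R (r / (2 * (`|u| + 1))))%R.
  rewrite lt_min invr_gt0 ltr0n divr_gt0 //= gt_min.
  by apply/orP; left; rewrite invf_lt1 // ltr1n.
set t := Num.min _ _; apply: rP; rewrite -ball_normE /=.
rewrite opprD addNKr normrN normrZ.
have t0 : (0 <= t)%R by rewrite le_min invr_ge0 ler0n divr_ge0 // ltW.
have tr : (t <= r / (2 * (`|u| + 1)))%R by rewrite ge_min lexx orbT.
rewrite (ger0_norm t0) (le_lt_trans (ler_wpM2r (normr_ge0 u) tr)) //.
rewrite mulrAC ltr_pdivrMr // ltr_pM2l //.
by have := normr_ge0 u; lra.
Qed.

Lemma dot_diff f x u : 'd (fine \o f) x u = dot (grad f x) u.
Proof.
rewrite {1}(row_sum_delta u) linear_sum /dot; apply: eq_bigr => i _.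
by rewrite linearZ /= mxE mulrC.
Qed.

Lemma differentiable_has_grad f x :
  differentiable (fine \o f) x -> has_grad (fine \o f) x (grad f x).
Proof.
move=> /diff_locally/eqaddoP h e e0.
have := h e e0 : \forall z \near (0%R : V), _.
rewrite (near_shift x) sub0r.
by apply: filterS => z /=; rewrite !fctE /= subrK dot_diff opprD addrA.
Qed.

HB.instance Definition _ v := @GRing.isLinear.Build R V R *%R (@dot R n v)
  (fun a x y => etrans (dotDr v (a *: x) y)
                       (congr1 (fun c => c + _)%R (dotZr a v x))).

Lemma has_grad_differentiable f x v : has_grad (fine \o f) x v ->
  differentiable (fine \o f) x /\ grad f x = v.
Proof.
move=> h.
have dc : continuous (dot v : {linear V -> R}) := @dot_continuous _ _ v.
have e : (fine \o f) \o shift x =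
    (cst ((fine \o f) x) + (dot v : {linear V -> R}))%R +o_ (0%R : V) id.
  apply/eqaddoP => e e0; suff : \forall z \near (0%R : V),
      (`|fine (f (z + x)) - (fine (f x) + dot v z)| <= e * `|z|)%R by [].
  rewrite (near_shift x) sub0r; apply: filterS (h e e0) => z /=.
  by rewrite subrK opprD addrA.
have d := diff_unique dc e.
split; first by apply/diff_locallyP; rewrite d.
by apply/rowP => i; rewrite mxE d /= dot_delta.
Qed.

(** A first-order lower estimate already pins the gradient down: test it in the
    direction [w - v]. *)
Lemma has_grad_lower_unique F x v w : has_grad F x v ->
  (forall e : R, (0 < e)%R ->
    \forall z \near x, (F x + dot w (z - x) - e * `|z - x| <= F z)%R) -> w = v.
Proof.
move=> Fv Fw; apply/eqP; rewrite -subr_eq0; apply/eqP.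
set u := (w - v)%R; apply: contrapT => u0.
have d0 : (0 < dot u u)%R.
  rewrite lt_neqAle dotvv_ge0 andbT; by apply/eqP => /esym/dotvv_eq0.
have c0 : (0 < 4 * (`|u| + 1) :> R)%R by rewrite mulr_gt0 // ltr_wpDl.
have e0 := divr_gt0 d0 c0; set e := (_ / _)%R in e0.
have [t /andP[t0 t1] []] := near_along u (filterI (Fv e e0) (Fw e e0)).
rewrite (addrC x) addrK dotZr dotZr normrZ (gtr0_norm t0) ler_norml.
move=> /andP[_ h1] h2.
have h3 : (t * dot u u <= t * (2 * e * `|u|))%R by rewrite {1}/u dotBl; lra.
move: h3; rewrite ler_pM2l // leNgt => /negP; apply.
have : (e * (4 * (`|u| + 1)) = dot u u)%R by rewrite divfK ?gt_eqF.
by have := mulr_ge0 (ltW e0) (normr_ge0 u); lra.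
Qed.

Lemma has_grad_unique F x v w : has_grad F x v -> has_grad F x w -> w = v.
Proof.
move=> Fv Fw; apply: (has_grad_lower_unique Fv) => e /Fw.
by apply: filterS => z; rewrite ler_norml => /andP[h _]; lra.
Qed.

Lemma has_grad_near F G x v : (\forall z \near x, F z = G z) ->
  has_grad F x v -> has_grad G x v.
Proof.
move=> FG Fv e /Fv; have FGx := nbhs_singleton FG.
by apply: filterS2 FG => z -> ; rewrite FGx.
Qed.

Lemma has_gradZ F x v (a : R) : (0 < a)%R ->
  has_grad F x v -> has_grad (fun z => a * F z)%R x (a *: v).
Proof.
move=> a0 Fv e e0; have := Fv _ (divr_gt0 e0 a0); apply: filterS => z h.
rewrite dotZl -!mulrBr normrM (gtr0_norm a0).
by apply: (le_trans (ler_wpM2l (ltW a0) h)); rewrite mulrCA mulrA divfK ?gt_eqF.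
Qed.

(** Along the segment towards [z], the chord bounds the slope from above. *)
Lemma convex_has_grad_le F x z v : has_grad F x v ->
  (forall t : R, (0 < t < 1)%R ->
    (F (x + t *: (z - x)) <= F x + t * (F z - F x))%R) ->
  (F x + dot v (z - x) <= F z)%R.
Proof.
move=> Fv Fc; rewrite leNgt; apply/negP => lt.
set d := (F x + dot v (z - x) - F z)%R.
have d0 : (0 < d)%R by rewrite subr_gt0.
have c0 : (0 < `|z - x| + 1 :> R)%R by rewrite ltr_wpDl.
have e0 := divr_gt0 d0 c0; set e := (_ / _)%R in e0.
have [t t01] := near_along (z - x) (Fv e e0).
have /andP[t0 t1] := t01; have := Fc t t01.
rewrite (addrC x) addrK dotZr normrZ (gtr0_norm t0) ler_norml => h1 /andP[h2 _].
have h3 : (t * d <= t * (e * `|z - x|))%R by rewrite /d; lra.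
move: h3; rewrite ler_pM2l // leNgt => /negP; apply.
rewrite /e mulrAC ltr_pdivrMr // ltr_pM2l //; lra.
Qed.

End Gradients.

(** * Convex epigraphs, subgradients and conjugates *)

Section Conjugates.
Context {R : realType} {n : nat}.
Local Notation V := 'rV[R]_n.
Implicit Types (F G : V -> \bar R) (x y z u v w eta : V) (A : set V).

Lemma convex_onP A F : convex_on A F <->
  forall x y (a b t : R), A x -> A y -> F x <= a%:E -> F y <= b%:E ->
    (0 <= t <= 1)%R ->
    A (t *: x + (1 - t) *: y)%R /\
    F (t *: x + (1 - t) *: y)%R <= (t * a + (1 - t) * b)%R%:E.
Proof.
split=> [cF x y a b t Ax Ay Fa Fb t01|cF [x a] [y b] l].
  have /andP[t0 t1] := t01.
  have := cF (x, a) (y, b) (@Itv01 R t t0 t1).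
  by rewrite !inE /epigraph_on /= => h; apply: h.
rewrite !inE /epigraph_on /= => -[Ax Fa] [Ay Fb].
have l01 : (0 <= l%:num <= 1)%R by rewrite ge0 le1.
exact: (cF x y a b l%:num Ax Ay Fa Fb l01).
Qed.

Lemma convex_onT F : convex_on setT F ->
  forall x y (a b t : R), F x <= a%:E -> F y <= b%:E ->
    (0 <= t <= 1)%R -> F (t *: x + (1 - t) *: y)%R <= (t * a + (1 - t) * b)%R%:E.
Proof.
by move=> /convex_onP cF x y a b t Fa Fb t01;
  have [] := cF x y a b t I I Fa Fb t01.
Qed.

Lemma convex_setP A : convex_set A <-> forall x y (t : R), A x -> A y ->
  (0 <= t <= 1)%R -> A (t *: x + (1 - t) *: y)%R.
Proof.
split=> [cA x y t Ax Ay t01|cA x y l].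
  have /andP[t0 t1] := t01.
  by have := cA x y (@Itv01 R t t0 t1); rewrite !inE => h; apply: h.
rewrite !inE => Ax Ay.
have l01 : (0 <= l%:num <= 1)%R by rewrite ge0 le1.
exact: (cA x y l%:num Ax Ay l01).
Qed.

Lemma convex_on_fineP A F (psi : V -> R) :
  (forall x y (t : R), A x -> A y -> (0 <= t <= 1)%R ->
    A (t *: x + (1 - t) *: y)%R) ->
  (forall x, A x -> F x = (psi x)%:E) ->
  convex_on A F <-> forall x y (t : R), A x -> A y -> (0 <= t <= 1)%R ->
    (psi (t *: x + (1 - t) *: y) <= t * psi x + (1 - t) * psi y)%R.
Proof.
move=> cA Fpsi; split=> [/convex_onP cF x y t Ax Ay t01|cpsi].
  have Fle z : A z -> F z <= (psi z)%:E by move=> Az; rewrite Fpsi.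
  have [Axy] := cF x y _ _ t Ax Ay (Fle x Ax) (Fle y Ay) t01.
  by rewrite (Fpsi _ Axy) lee_fin.
apply/convex_onP => x y a b t Ax Ay; rewrite (Fpsi x Ax) (Fpsi y Ay) !lee_fin.
move=> ha hb t01.
have cxy := cA x y t Ax Ay t01; split => //; rewrite Fpsi // lee_fin.
apply: (le_trans (cpsi x y t Ax Ay t01)); case/andP: t01 => t0 t1.
by rewrite lerD // ler_wpM2l // subr_ge0.
Qed.

(** Finiteness of [G x] excludes the spurious case [G x = -oo], in which every
    slope is a subgradient. *)
Definition touch G x eta := G x \is a fin_num /\ subdiff G x eta.

Lemma touchP G x eta : touch G x eta <->
  exists2 r : R, G x = r%:E & forall z, (r + dot eta (z - x))%R%:E <= G z.
Proof.
split=> [[Gx h]|[r Gx h]]; last first.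
  by split; rewrite /subdiff /= Gx.
exists (fine (G x)); first by rewrite fineK.
by move=> z; have := h z; rewrite -[in X in X -> _](fineK Gx) -EFinD.
Qed.

Lemma conjugate_leP G eta (c : R) :
  conjugate G eta <= c%:E <-> forall x, (dot eta x - c)%R%:E <= G x.
Proof.
have e x : ((dot eta x)%:E - G x <= c%:E) = ((dot eta x - c)%R%:E <= G x).
  by case: (G x) => [r| |] //=; rewrite ?lee_fin ?leNye ?leey // lerBlDr lerBlDl.
split=> [h x|h].
  by rewrite -e (le_trans _ h) //; apply: ereal_sup_ubound; exists x.
by apply: ge_ereal_sup => _ [x _ <-]; rewrite e.
Qed.

Lemma conjugate_ge G x eta (r : R) : G x <= r%:E ->
  (dot eta x - r)%R%:E <= conjugate G eta.
Proof.
move=> Gr; apply: (@le_trans _ _ ((dot eta x)%:E - G x)).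
  by rewrite EFinB leeD2l // leeN2.
by apply: ereal_sup_ubound; exists x.
Qed.

Lemma conjugate_gtNy G x eta : G x < +oo -> -oo < conjugate G eta.
Proof.
move=> Gx; have [r Gr] : exists r : R, G x <= r%:E.
  by case: (G x) Gx => [r| |] // _; [exists r|exists 0%R; rewrite leNye].
exact: lt_le_trans (ltNyr _) (conjugate_ge eta Gr).
Qed.

Lemma conjugate_touch G x eta : touch G x eta ->
  conjugate G eta = (dot eta x - fine (G x))%R%:E.
Proof.
move=> /touchP[r Gx h]; rewrite Gx /=; apply/eqP; rewrite eq_le.
rewrite conjugate_ge ?Gx // andbT; apply/conjugate_leP => z.
by apply: le_trans (h z); rewrite lee_fin dotBr; lra.
Qed.

Lemma conjugate_touch_le G x eta eta' : touch G x eta ->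
  (fine (conjugate G eta) + dot (eta' - eta) x)%R%:E <= conjugate G eta'.
Proof.
move=> t; rewrite (conjugate_touch t) /=; case/touchP: t => r Gx _.
have := @conjugate_ge G x eta' r; rewrite Gx lexx => /(_ isT).
by apply: le_trans; rewrite lee_fin dotBl /=; lra.
Qed.

Lemma conjugate_convex G : convex_on setT (conjugate G).
Proof.
apply/convex_onP => v w a b t _ _ /conjugate_leP va /conjugate_leP wb.
move=> /andP[t0 t1]; split => //; apply/conjugate_leP => x.
have := va x; have := wb x; case: (G x) => [r| |] //=; rewrite ?leey //.
rewrite !lee_fin !dotE => h1 h2.
have := ler_wpM2l t0 h2; have := @ler_wpM2l _ (1 - t)%R _ _ _ h1.
by rewrite subr_ge0 => /(_ t1); lra.
Qed.

Lemma conjugate_lsc G : lower_semicontinuous (conjugate G).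
Proof.
move=> eta a /ereal_sup_gt[_ [x _ <-]] h.
exists [set z | a%:E < conjugate G z] => //.
have [r Gr ar] : exists2 r : R, G x <= r%:E & (a < dot eta x - r)%R.
  case: (G x) h => [r| |] //=; first by rewrite -EFinB lte_fin => h; exists r.
  by move=> _; exists (dot eta x - a - 1)%R; rewrite ?leNye //; lra.
have e0 : (0 < dot eta x - r - a)%R by rewrite subr_gt0.
have /(@cvgrPdist_lt _ _ _ (nbhs eta))/(_ _ e0) := @dot_continuous _ _ x eta.
apply: filterS => z; rewrite ltr_norml => /andP[_ hz] /=.
apply: lt_le_trans (conjugate_ge z Gr); rewrite lte_fin.
by move: hz; rewrite !(dotC x); lra.
Qed.

Lemma intdom_edom F y : intdom F y -> edom F y.
Proof. exact: interior_subset. Qed.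

Lemma nbhs_intdom F y : intdom F y -> nbhs y (intdom F).
Proof. by move=> Fy; apply: open_nbhs_nbhs; split => //; exact: open_interior. Qed.

(** Affine minorants of [F] cannot be steep over an interior point of its
    domain: [F] is finite at the [2 n] points [y +- d e_i]. *)
Lemma minorant_bound F y : intdom F y ->
  exists2 d : R, (0 < d)%R & exists C : R, forall v (b : R),
    (forall z, (dot v z + b)%R%:E <= F z) ->
    (d * `|v| + dot v y + b <= C)%R.
Proof.
move=> /nbhs_ballP[r /= r0 rF].
have d0 : (0 < r / 2 :> R)%R by rewrite divr_gt0.
set d := (r / 2)%R in d0.
pose s i (e : R) := (y + (e * d) *: delta_mx ord0 i)%R : V.
exists d => //; exists (`|fine (F y)| + \sum_(i < n)
  (`|fine (F (s i 1%R))| + `|fine (F (s i (-1)%R))|))%R => v b vF.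
set S := (\sum_(i < n) _)%R.
have S0 : (0 <= S)%R by apply: sumr_ge0 => i _; exact: addr_ge0.
have finF z : F z < +oo -> (dot v z + b <= `|fine (F z)|)%R.
  have := vF z; case: (F z) => [a| |] //=; rewrite lee_fin => h _.
  exact: le_trans h (ler_norm _).
have h0 : (dot v y + b <= `|fine (F y)|)%R by apply: finF; apply: rF; exact: ballxx.
have hs i (e : R) : (`|e| = 1)%R ->
    (e * d * v ord0 i + dot v y + b <= `|fine (F (s i e))|)%R.
  move=> e1; rewrite -dot_delta -dotZr -addrA addrC addrAC -dotDr.
  apply: finF; apply: rF; rewrite -ball_normE /= opprD addNKr normrN normrZ.
  rewrite normrM e1 mul1r (gtr0_norm d0) (@le_lt_trans _ _ d) //.
    2: by rewrite /d; lra.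
  rewrite ler_piMr ?(ltW d0) //; apply: norm_leP => [|j]; first exact: ler01.
  by rewrite mxE eqxx /=; case: (j == i); rewrite ?normr1 ?normr0.
have hi i : (d * `|v ord0 i| <= `|fine (F y)| + S - dot v y - b)%R.
  have Si : (`|fine (F (s i 1%R))| + `|fine (F (s i (-1)%R))| <= S)%R.
    by rewrite /S (bigD1 i) //= lerDl sumr_ge0 // => j _; exact: addr_ge0.
  have := hs i 1%R (normr1 _); have := hs i (-1)%R; rewrite normrN1 => /(_ erefl).
  have := normr_ge0 (fine (F y)).
  have := normr_ge0 (fine (F (s i 1%R))); have := normr_ge0 (fine (F (s i (-1)%R))).
  have [v0|v0] := ler0P (v ord0 i); lra.
suff : (`|v| <= (`|fine (F y)| + S - dot v y - b) / d)%R.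
  by rewrite ler_pdivlMr // (mulrC _ d) => h; lra.
apply: norm_leP => [|i]; last by rewrite ler_pdivlMr // mulrC.
by apply: divr_ge0; [lra|exact: ltW].
Qed.

End Conjugates.

(** * Existence and stability of touching points *)

Section Minimization.
Context {R : realType} {n : nat}.
Local Notation V := 'rV[R]_n.
Implicit Types (F G Q : V -> \bar R) (x y z u v w eta : V) (A K : set V).

Lemma ereal_dense (c : R) (e : \bar R) : c%:E < e ->
  exists2 b : R, (c < b)%R & b%:E < e.
Proof.
case: e => [r| |] //; last by move=> _; exists (c + 1)%R; rewrite ?ltry // ltrDl.
by rewrite lte_fin => cr; exists ((c + r) / 2)%R; rewrite ?lte_fin; lra.
Qed.

Lemma ler_vanishing (a b k : R) :
  (forall t : R, (0 < t < 1)%R -> (a <= b + t * k)%R) -> (a <= b)%R.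
Proof.
move=> h; apply/ler_addgt0Pr => e e0.
have k0 : (0 < `|k| + 1 :> R)%R by rewrite ltr_wpDl.
pose t := Num.min (2^-1)%R (e / (`|k| + 1))%R.
have t0 : (0 < t)%R by rewrite lt_min invr_gt0 ltr0n divr_gt0.
have t1 : (t < 1)%R by rewrite gt_min invf_lt1 ?ltr1n.
apply: (le_trans (h t _)); first by rewrite t0.
have : (t * (`|k| + 1) <= e)%R by rewrite -ler_pdivlMr // ge_min lexx orbT.
have := ler_wpM2l (ltW t0) (ler_norm k); lra.
Qed.

Lemma lsc_compact_gap G K (c : R) : lower_semicontinuous G -> compact K ->
  (forall x, K x -> c%:E < G x) ->
  exists2 a : R, (c < a)%R & forall x, K x -> a%:E <= G x.
Proof.
move=> lG /compact_near_coveringP/(_ R (at_right c) (fun a x => a%:E <= G x)).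
move=> cK KG; have {}cK : \forall a \near at_right c, K `<=` (fun x => a%:E <= G x).
  apply: cK => x Kx; have [b cb bG] := ereal_dense (KG x Kx).
  have [U Ux UG] := lG x b bG.
  exists (U, [set a | (a < b)%R]); first by split => //; exact: nbhs_right_lt.
  move=> [z a] [/= Uz ab]; apply: ltW; apply: lt_trans (UG z Uz).
  by rewrite lte_fin.
have [a [ca Ka]] := filter_ex (filterI (nbhs_right_gt c) cK).
by exists a.
Qed.

Lemma compact_ball_setI (r : R) (A : set V) : closed A ->
  compact ([set x | (`|x| <= r)%R] `&` A).
Proof.
move=> cA; apply: bounded_closed_compact.
  exists r; split; first exact: num_real.
  by move=> M rM x [/= xr _]; exact: le_trans xr (ltW rM).
apply: closedI => //.
have -> : [set x : V | (`|x| <= r)%R] =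
    (fun x : V => `|x|%R) @^-1` [set a | (a <= r)%R] by [].
refine (@preimage_closed V R (fun x : V => `|x|%R) _ _ _); last exact: closed_le.
by move=> x _; exact: norm_continuous.
Qed.

Lemma lsc_attains Q x0 (r0 c0 b : R) : lower_semicontinuous Q ->
  Q x0 <= r0%:E -> (forall x, c0%:E <= Q x) ->
  (forall x, (b < `|x|)%R -> Q x0 <= Q x) ->
  exists x, exists2 m : R, Q x = m%:E & forall z, m%:E <= Q z.
Proof.
move=> lQ Q0 Qc Qb; apply: contrapT => nQ.
pose M := ereal_inf (range Q).
have MQ z : M <= Q z by apply: ereal_inf_lbound; exists z.
have cM : c0%:E <= M by apply: le_ereal_inf_tmp => _ [z _ <-].
have [m Mm] : exists m : R, M = m%:E.
  have := le_trans (MQ x0) Q0; move: cM; case: (M) => [m| |] //; by exists m.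
have mQ z : m%:E < Q z.
  rewrite lt_neqAle -Mm MQ andbT; apply/eqP => Qz; apply: nQ; exists z, m.
    by rewrite -Qz.
  by move=> z'; rewrite -Mm.
pose B := (Num.max b `|x0|)%R.
have [a ma aQ] := lsc_compact_gap lQ (compact_ball_setI (r := B) closedT)
                    (fun x _ => mQ x).
have : a%:E <= M.
  apply: le_ereal_inf_tmp => _ [z _ <-]; have [zB|zB] := leP `|z|%R B.
    exact: aQ.
  apply: (@le_trans _ _ (Q x0)).
    by apply: aQ; split => //=; rewrite le_max lexx orbT.
  by apply: Qb; apply: le_lt_trans zB; rewrite le_max lexx.
by rewrite Mm lee_fin leNgt ma.
Qed.

Lemma lsc_addr G (q : V -> R) : lower_semicontinuous G ->
  (forall x (e : R), (0 < e)%R -> \forall z \near x, (q x - e < q z)%R) ->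
  lower_semicontinuous (fun x => G x + (q x)%:E).
Proof.
move=> lG lq x a; rewrite -lteBlDr // -EFinB => /ereal_dense[b ab].
move=> /lG[U Ux UG]; have e0 : (0 < b - (a - q x))%R by rewrite subr_gt0.
exists (U `&` [set z | (q x - (b - (a - q x)) < q z)%R]).
  by apply: filterI => //; exact: lq.
move=> z [/UG bz /= qz]; rewrite -lteBlDr // -EFinB; apply: le_lt_trans bz.
by rewrite lee_fin; lra.
Qed.

Lemma lsc_tilt G eta : lower_semicontinuous G ->
  lower_semicontinuous (fun x => G x + (- dot eta x)%R%:E).
Proof.
move=> lG; apply: lsc_addr => // x e e0.
have /(@cvgrPdist_lt _ _ _ (nbhs x))/(_ _ e0) := @dot_continuous _ _ eta x.
by apply: filterS => z; rewrite ltr_norml => /andP[h _]; lra.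
Qed.

(** Interior slopes see a coercive function: this is [minorant_bound] for the
    conjugate, whose affine minorants are indexed by the points of [R^n]. *)
Lemma coercive_of_intdom G eta : intdom (conjugate G) eta ->
  exists2 d : R, (0 < d)%R &
    exists C : R, forall x, (dot eta x + d * `|x| - C)%R%:E <= G x.
Proof.
move=> Ge; have [d d0 [C dC]] := minorant_bound Ge; exists d => //; exists C => x.
have minor (r : R) : G x <= r%:E ->
    forall z, (dot x z + - r)%R%:E <= conjugate G z.
  by move=> Gr z; rewrite dotC; exact: conjugate_ge.
case: (G x) minor => [r| |] minor; rewrite ?leey //.
  have := dC x (- r)%R (minor r (lexx _)).
  by rewrite lee_fin (dotC x) => h; lra.
pose c := (C + 1 - (d * `|x| + dot x eta))%R.
have /dC : forall z, (dot x z + c)%R%:E <= conjugate G z.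
  by move=> z; have := minor (- c)%R (leNye _) z; rewrite opprK.
by rewrite /c => h; exfalso; lra.
Qed.

Lemma touch_exists G x0 eta : lower_semicontinuous G -> G x0 < +oo ->
  intdom (conjugate G) eta -> exists x, touch G x eta.
Proof.
move=> lG G0 /coercive_of_intdom[d d0 [C dC]].
have [r0 Gr0] : exists r : R, G x0 = r%:E.
  by have := dC x0; case: (G x0) G0 => [r| |] // _ _; exists r.
have [||x|x|x [m Qx Qm]] := @lsc_attains (fun x => G x + (- dot eta x)%R%:E) x0
  (r0 - dot eta x0)%R (- C)%R ((r0 - dot eta x0 + C) / d)%R.
- exact: lsc_tilt.
- by rewrite Gr0.
- rewrite -leeBlDr // -EFinB; apply: le_trans (dC x); rewrite lee_fin.
  by have := mulr_ge0 (ltW d0) (normr_ge0 x); lra.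
- rewrite ltr_pdivrMr // => h; rewrite Gr0 -EFinD -leeBlDr // -EFinB.
  by apply: le_trans (dC x); rewrite lee_fin; lra.
exists x; apply/touchP; exists (m + dot eta x)%R.
  by move: Qx; case: (G x) => [r| |] //= [<-]; congr (_%:E); lra.
move=> z; have := Qm z; rewrite -leeBlDr // -EFinB; apply: le_trans.
by rewrite lee_fin dotBr; lra.
Qed.

(** Quantitative uniqueness of the touching point: away from [x] the gap between
    [G] and its tangent grows at least linearly.  This is what survives a small
    change of the slope. *)
Definition sharp G x eta := forall e : R, (0 < e)%R ->
  exists2 m : R, (0 < m)%R & forall z, (e <= `|z - x|)%R ->
    (fine (G x) + dot eta (z - x) + m * `|z - x|)%R%:E <= G z.

Lemma unique_touch_gap G x eta z : touch G x eta ->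
  (forall x', touch G x' eta -> x' = x) -> z <> x ->
  (fine (G x) - dot eta x)%R%:E < G z + (- dot eta z)%R%:E.
Proof.
move=> /touchP[r -> rG] ux zx; rewrite lt_neqAle /=; apply/andP; split; last first.
  rewrite -leeBlDr // -EFinB; apply: le_trans (rG z).
  by rewrite lee_fin dotBr; lra.
apply/eqP => eq; apply: zx; apply: ux; apply/touchP.
exists (r - dot eta x + dot eta z)%R.
  by move: eq; case: (G z) => [s| |] //= [->]; congr (_%:E); lra.
by move=> z'; apply: le_trans (rG z'); rewrite lee_fin !dotBr; lra.
Qed.

Lemma unique_touch_sharp G x eta : lower_semicontinuous G ->
  intdom (conjugate G) eta -> touch G x eta ->
  (forall x', touch G x' eta -> x' = x) -> sharp G x eta.
Proof.
move=> lG Ge tx ux e e0; have [d d0 [C dC]] := coercive_of_intdom Ge.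
have /touchP[r Gx rG] := tx; rewrite Gx /=.
pose q0 := (r - dot eta x)%R.
pose B := (2 * (C + q0) / d + `|x|)%R.
have cK := @compact_ball_setI B (~` ball x e) (open_closedC (ball_open x e)).
have gapK z : ([set z | (`|z| <= B)%R] `&` ~` ball x e) z ->
    q0%:E < G z + (- dot eta z)%R%:E.
  move=> [_ /= zx]; have := unique_touch_gap (z := z) tx ux.
  by rewrite Gx; apply=> zE; apply: zx; rewrite zE; exact: ballxx.
have [a qa aK] := lsc_compact_gap (lsc_tilt (eta := eta) lG) cK gapK.
pose D := (`|B| + `|x| + 1)%R.
have D0 : (0 < D)%R by rewrite /D ltr_wpDl // addr_ge0.
have aD0 : (0 < (a - q0) / D)%R by rewrite divr_gt0 // subr_gt0.
exists (Num.min (d / 2) ((a - q0) / D))%R; first by rewrite lt_min divr_gt0.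
set m := Num.min _ _ => z ez.
have md : (m * `|z - x| <= d / 2 * `|z - x|)%R.
  by rewrite ler_wpM2r // ge_min lexx.
have mD : (m * `|z - x| <= (a - q0) / D * `|z - x|)%R.
  by rewrite ler_wpM2r // ge_min lexx orbT.
have zxn : (`|z - x| <= `|z| + `|x|)%R := ler_normB z x.
have [zB|Bz] := leP `|z|%R B.
  have := aK z; rewrite -leeBlDr // -EFinB => az.
  apply: le_trans (az _).
    have zD : (`|z - x| <= D)%R by have := ler_norm B; rewrite /D; lra.
    have : ((a - q0) / D * `|z - x| <= a - q0)%R.
      by rewrite mulrAC ler_pdivrMr // ler_pM2l // subr_gt0.
    by rewrite lee_fin dotBr; move: mD; rewrite /q0; lra.
  by split => //=; rewrite -ball_normE /= distrC; apply/negP; rewrite -leNgt.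
apply: le_trans (dC z); rewrite lee_fin dotBr.
have : (2 * (C + q0) / d <= `|z| - `|x|)%R by rewrite lerBrDr; exact: ltW.
rewrite ler_pdivrMr //.
have := ler_wpM2l (ltW d0) zxn; move: md; rewrite /q0; lra.
Qed.

(** Tilting by [eta' - eta] changes [G] at [z] by at most a multiple of
    [|eta' - eta| |z - x|], which the linear growth outside the [e]-ball absorbs. *)
Lemma sharp_near G x eta (e : R) : touch G x eta -> sharp G x eta ->
  (0 < e)%R ->
  \forall eta' \near eta, forall x', touch G x' eta' -> (`|x' - x| < e)%R.
Proof.
move=> /touchP[r Gx _] sx e0; have [m m0] := sx e e0; rewrite Gx /= => mG.
have n0 : (0 < m / n.+1%:R)%R by rewrite divr_gt0.
apply: filterS (nbhsx_ballx eta _ n0) => eta'; rewrite -ball_normE /=.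
rewrite ltr_pdivlMr // => he x' /touchP[r' Gx' /(_ x)].
rewrite Gx lee_fin => h1; rewrite ltNge; apply/negP => ex.
have := mG x' ex; rewrite Gx' lee_fin => h2.
have xx0 : (0 < `|x' - x|)%R by exact: lt_le_trans ex.
have h3 : (m * `|x' - x| <= dot (eta' - eta) (x' - x))%R.
  by move: h1 h2; rewrite dotBl -(opprB x' x) dotNr; lra.
have := le_trans h3 (le_trans (ler_norm _) (dot_le _ _)).
rewrite ler_pM2r // leNgt distrC => /negP; apply; apply: le_lt_trans he.
by rewrite mulrC ler_wpM2l // ler_nat.
Qed.

(** The linear growth leaves room for every nearby slope. *)
Lemma sharp_intdom G x eta : touch G x eta -> sharp G x eta ->
  intdom (conjugate G) eta.
Proof.
move=> /touchP[r Gx rG] /(_ 1%R ltr01)[m m0]; rewrite Gx /= => mG.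
have n0 : (0 < m / n.+1%:R)%R by rewrite divr_gt0.
apply: filterS (nbhsx_ballx eta _ n0) => eta'; rewrite -ball_normE /=.
rewrite ltr_pdivlMr // => he.
apply: (@le_lt_trans _ _ (dot eta' x - r + m)%R%:E); last exact: ltry.
apply/conjugate_leP => z.
have hz : (dot (eta' - eta) (z - x) <= m * `|z - x|)%R.
  apply: (le_trans (ler_norm _)); apply: (le_trans (dot_le _ _)).
  rewrite ler_wpM2r // distrC; apply: le_trans (ltW he).
  by rewrite mulrC ler_wpM2l // ler_nat.
have [z1|z1] := leP 1%R `|z - x|%R.
  apply: le_trans (mG z z1); rewrite lee_fin.
  by move: hz; rewrite dotBl !dotBr; lra.
apply: le_trans (rG z); rewrite lee_fin.
have := ler_wpM2l (ltW m0) (ltW z1).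
by move: hz; rewrite dotBl !dotBr; lra.
Qed.

Lemma conjugate_fin G x0 eta : G x0 < +oo -> intdom (conjugate G) eta ->
  conjugate G eta \is a fin_num.
Proof.
move=> G0 /intdom_edom /= Ge; rewrite fin_numElt Ge andbT.
exact: conjugate_gtNy G0.
Qed.

(** Danskin: where the touching point is unique the conjugate is differentiable,
    because the touching points of nearby slopes [eta'] are near and bracket the
    increment between [<eta' - eta, x>] and [<eta' - eta, x'>]. *)
Lemma conjugate_has_grad G x0 x eta : lower_semicontinuous G -> G x0 < +oo ->
  intdom (conjugate G) eta -> touch G x eta ->
  (forall x', touch G x' eta -> x' = x) ->
  has_grad (fine \o conjugate G) eta x.
Proof.
move=> lG G0 Ge tx ux e e0.
have n0 : (0 < e / n.+1%:R)%R by rewrite divr_gt0.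
have := sharp_near tx (unique_touch_sharp lG Ge tx ux) n0.
apply: filterS2 (nbhs_intdom Ge) => eta' Ge' near_x.
have [x' tx'] := touch_exists lG G0 Ge'; have xx' := near_x x' tx'.
have := conjugate_touch_le eta' tx; have := conjugate_touch_le eta tx'.
rewrite /= (conjugate_touch tx) (conjugate_touch tx') /= !lee_fin => h1 h2.
rewrite ger0_norm; last by rewrite (dotC x); lra.
have -> : (e * `|eta' - eta| = n.+1%:R * `|eta' - eta| * (e / n.+1%:R))%R.
  by rewrite [RHS]mulrC mulrA divfK // pnatr_eq0.
apply: (@le_trans _ _ (dot (eta' - eta) (x' - x))).
  by move: h1; rewrite -(opprB eta') dotNl (dotC x) dotBr; lra.
apply: (le_trans (ler_norm _)); apply: (le_trans (dot_le _ _)).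
by rewrite ler_pM ?mulr_ge0 ?ler_wpM2r ?ler_nat // ltW.
Qed.

End Minimization.

(** * Resolvents *)

Section Resolvents.
Context {R : realType} {n : nat}.
Local Notation V := 'rV[R]_n.
Implicit Types (F G : V -> \bar R) (x y z u v w eta : V).

(** Surjectivity of [x + mu^-1 df x]: [w] is reached at the minimizer of
    [F + mu / 2 |. - w|^2], and there the quadratic term contributes only to
    second order along segments, which convexity of [F] turns into a
    subgradient inequality. *)
Lemma resolvent_exists F x0 v (b mu : R) w : lower_semicontinuous F ->
  convex_on setT F -> F x0 < +oo -> (forall z, (dot v z + b)%R%:E <= F z) ->
  (0 < mu)%R -> exists x, touch F x (mu *: (w - x)).
Proof.
move=> lF cF F0 vF mu0.
have [r0 Fr0] : exists r : R, F x0 = r%:E.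
  by have := vF x0; case: (F x0) F0 => [r| |] // _ _; exists r.
pose q z := (mu / 2 * dot (z - w) (z - w))%R.
have q_ge0 z : (0 <= q z)%R by rewrite mulr_ge0 ?dotvv_ge0 // divr_ge0 // ltW.
have lq x (e : R) : (0 < e)%R -> \forall z \near x, (q x - e < q z)%R.
  move=> e0; have e'0 : (0 < e / (mu * (n.+1%:R * (`|x - w| + 1))))%R.
    by rewrite divr_gt0 // !mulr_gt0 // ltr_wpDl.
  apply: filterS (nbhsx_ballx x _ e'0) => z; rewrite -ball_normE /=.
  rewrite ltr_pdivlMr ?mulr_gt0 ?ltr_wpDl // => h.
  have h1 := le_trans (ler_norm _) (dot_le (x - w) (x - z)).
  have h2 : (n%:R * `|x - w| * `|x - z| <= n.+1%:R * (`|x - w| + 1) * `|x - z|)%R.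
    by rewrite ler_wpM2r // ler_pM // ?ler_nat // lerDl.
  have := ler_wpM2l (ltW mu0) (le_trans h1 h2).
  have := mulr_ge0 (ltW mu0) (dotvv_ge0 (x - z)).
  have -> : (dot (x - w) (x - z) = dot (x - w) (x - w) - dot (x - w) (z - w))%R.
    by rewrite -dotBr opprB addrA subrK.
  by rewrite /q !dotBl !dotBr (dotC z x) (dotC w x) (dotC w z); lra.
(* completing the square *)
have vq u (c : R) : (0 < c)%R -> (- dot v v / (4 * c) <= dot v u + c * dot u u)%R.
  move=> c0; have := dotvv_ge0 ((2 * c) *: u + v)%R.
  rewrite ler_pdivrMr ?mulr_gt0 // !dotE (dotC u v); lra.
pose b' := (dot v w + b)%R.
have Fb u : (dot v u + b')%R%:E <= F (u + w)%R.
  by apply: le_trans (vF _); rewrite lee_fin dotDr /b'; lra.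
pose c1 := (b' - dot v v / (4 * (mu / 4)))%R.
pose B := (1 + 4 / mu * (`|r0 + q x0| + `|c1|))%R.
have [||x|x|x [m Qx Qm]] := @lsc_attains R n (fun z => F z + (q z)%:E) x0
  (r0 + q x0)%R (b' - dot v v / (4 * (mu / 2)))%R (B + `|w|)%R.
- exact: lsc_addr.
- by rewrite Fr0.
- have := Fb (x - w)%R; rewrite subrK => h.
  apply: le_trans (leeD2r (q x)%:E h); rewrite lee_fin /q.
  by have := vq (x - w)%R (mu / 2)%R; rewrite divr_gt0 // => /(_ isT); lra.
- move=> Bx; have xw : (B < `|x - w|)%R.
    by have := ler_normD (x - w)%R w; rewrite subrK; lra.
  have := Fb (x - w)%R; rewrite subrK => h; rewrite Fr0.
  apply: le_trans (leeD2r (q x)%:E h); rewrite lee_fin /q.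
  have := vq (x - w)%R (mu / 4)%R; rewrite divr_gt0 // => /(_ isT).
  have B1 : (1 <= B)%R.
    by rewrite lerDl mulr_ge0 ?addr_ge0 // divr_ge0 // ltW.
  have h1 : (`|x - w| <= dot (x - w) (x - w))%R.
    apply: le_trans (sqr_norm_le_dot _).
    by rewrite expr2 ler_peMl //; exact: ltW (le_lt_trans B1 xw).
  have h2 : (`|r0 + q x0| + `|c1| <= mu / 4 * dot (x - w) (x - w))%R.
    rewrite -ler_pdivrMl ?divr_gt0 // invf_div.
    by move: xw; rewrite /B; lra.
  have := ler_norm (r0 + q x0)%R; have := ler_norm (- c1)%R; rewrite normrN.
  by move: h2; rewrite /c1 /q; lra.
exists x; apply/touchP; exists (m - q x)%R.
  by move: Qx; case: (F x) => [r| |] //= [<-]; congr (_%:E); lra.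
have Fx : F x = (m - q x)%R%:E.
  by move: Qx; case: (F x) => [r| |] //= [<-]; congr (_%:E); lra.
move=> z; have := vF z; case Fz : (F z) => [s| |] _ //; last by rewrite leey.
rewrite lee_fin; have [d dE] : exists d, d = (z - x)%R by exists (z - x)%R.
rewrite -dE.
apply: (@ler_vanishing _ _ _ (mu / 2 * dot d d)) => t /andP[t0 t1].
have t01 : (0 <= t <= 1)%R by rewrite !ltW.
have := convex_onT cF (y := x) (a := s) (b := (m - q x)%R) _ _ t01.
move=> /(_ z); rewrite Fz Fx !lexx => /(_ isT isT).
have -> : (t *: z + (1 - t) *: x = x + t *: d)%R.
  by rewrite dE scalerBl scale1r scalerBr addrCA addrA.
move=> /(leeD2r (q (x + t *: d)%R)%:E)/(le_trans (Qm _)); rewrite lee_fin /q.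
rewrite (_ : x + t *: d - w = (x - w) + t *: d)%R; last by rewrite addrAC.
have [u uE] : exists u, u = (x - w)%R by exists (x - w)%R.
rewrite -(opprB x w) -uE scalerN dotNl dotZl !(dotDl, dotDr, dotZl, dotZr).
rewrite (dotC d u) => h; rewrite -(ler_pM2l t0); lra.
Qed.

(** If every [w = x + e eta] with [eta] a subgradient at [x] (Minty), then [G] at
    [w] is recovered from its tangents: the tangent values
    [G x + <eta, w - x> = G x + e |eta|^2] bounded by [c] force [x] to tend to
    [w] as [e] vanishes. *)
Lemma le_of_resolvents G v (b : R) w (c : R) : lower_semicontinuous G ->
  (forall z, (dot v z + b)%R%:E <= G z) ->
  (forall e : R, (0 < e)%R -> exists x eta, [/\ touch G x eta,
     (x + e *: eta = w)%R & (fine (G x) + dot eta (w - x) <= c)%R]) ->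
  G w <= c%:E.
Proof.
move=> lG vG res; rewrite leNgt; apply/negP => /lG[U /nbhs_ballP[r /= r0 rU] UG].
pose k := (`|2 * (c - b - dot v w)| + dot v v + 1)%R.
have k0 : (0 < k)%R by rewrite /k ltr_wpDl // addr_ge0 // dotvv_ge0.
pose e := Num.min 1%R (r ^+ 2 / k)%R.
have e0 : (0 < e)%R by rewrite lt_min ltr01 divr_gt0 // exprn_gt0.
have e1 : (e <= 1)%R by rewrite ge_min lexx.
have [x [eta [/touchP[s Gx _] xw]]] := res e e0; rewrite Gx /=.
have -> : (w - x = e *: eta)%R by rewrite -xw addrC addKr.
rewrite dotZr => sc.
have ee : (0 <= e * dot eta eta)%R by rewrite mulr_ge0 ?dotvv_ge0 // ltW.
have := vG x; rewrite Gx lee_fin => bs.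
suff /rU/UG : ball w r x by rewrite Gx lte_fin; lra.
rewrite -ball_normE /= (_ : w - x = e *: eta)%R; last by rewrite -xw addrC addKr.
rewrite -(@ltr_pXn2r _ 2) // ?nnegrE ?(ltW r0) //.
apply: le_lt_trans (sqr_norm_le_dot _) _; rewrite dotZl dotZr.
have vw : (dot v w = dot v x + e * dot v eta)%R by rewrite -xw dotDr dotZr.
have young : (2 * e * dot v eta <= e * dot v v + e * dot eta eta)%R.
  have := mulr_ge0 (ltW e0) (dotvv_ge0 (v - eta)%R).
  by rewrite !dotE (dotC eta v); lra.
have bound : (e * dot eta eta < k)%R.
  have := ler_norm (2 * (c - b - dot v w))%R.
  have := ler_wpM2r (dotvv_ge0 v) e1; rewrite /k; lra.
have ek : (e * k <= r ^+ 2)%R by rewrite -ler_pdivlMr // ge_min lexx orbT.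
by apply: lt_le_trans ek; rewrite ltr_pM2l.
Qed.

End Resolvents.

(** * Legendre duality *)

Section ConvexSegments.
Context {R : realType} {n : nat}.
Local Notation V := 'rV[R]_n.
Implicit Types (F G : V -> \bar R) (x y z u v w eta : V).

Lemma edom_convex F x y (t : R) : convex_on setT F -> edom F x -> edom F y ->
  (0 <= t <= 1)%R -> edom F (t *: x + (1 - t) *: y)%R.
Proof.
move=> cF Fx Fy t01.
have up z : edom F z -> exists a : R, F z <= a%:E.
  rewrite /edom /=; case: (F z) => [a| |] // _; first by exists a.
  by exists 0%R; rewrite leNye.
have [[a Fa] [b Fb]] := (up x Fx, up y Fy).
exact: le_lt_trans (convex_onT cF Fa Fb t01) (ltry _).
Qed.

Lemma intdom_segment F x y (t : R) : convex_on setT F -> edom F x ->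
  intdom F y -> (0 < t <= 1)%R -> intdom F (t *: y + (1 - t) *: x)%R.
Proof.
move=> cF Fx /nbhs_ballP[r /= r0 rF] /andP[t0 t1].
have tr0 : (0 < t * r)%R by rewrite mulr_gt0.
apply: filterS (nbhsx_ballx _ _ tr0) => z; rewrite -ball_normE /= => h.
pose y' := (t^-1 *: (z - (1 - t) *: x))%R.
have -> : (z = t *: y' + (1 - t) *: x)%R.
  by rewrite /y' scalerA divff ?gt_eqF // scale1r subrK.
apply: edom_convex => //; last by rewrite ltW.
apply: rF; rewrite -ball_normE /=.
have -> : (y - y' = t^-1 *: (t *: y + (1 - t) *: x - z))%R.
  rewrite -addrA -(opprB z) scalerBr scalerA mulVf ?gt_eqF // scale1r.
  by rewrite /y'.
by rewrite normrZ gtr0_norm ?invr_gt0 // mulrC ltr_pdivrMr // mulrC.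
Qed.

Lemma intdom_convex F x y (t : R) : convex_on setT F -> intdom F x ->
  intdom F y -> (0 <= t <= 1)%R -> intdom F (t *: x + (1 - t) *: y)%R.
Proof.
move=> cF Fx Fy /andP[t0 t1]; move: t0; rewrite le_eqVlt => /orP[/eqP<-|t0].
  by rewrite scale0r subr0 scale1r add0r.
by apply: intdom_segment; rewrite ?t0 //; exact: intdom_edom.
Qed.

(** For convex functions the gap over a sphere around [x] propagates outwards
    along rays. *)
Lemma convex_unique_touch_sharp F x eta : lower_semicontinuous F ->
  convex_on setT F -> touch F x eta ->
  (forall x', touch F x' eta -> x' = x) -> sharp F x eta.
Proof.
move=> lF cF tx ux e e0; have /touchP[r Fx rF] := tx; rewrite Fx /=.
pose q0 := (r - dot eta x)%R.
have cK := @compact_ball_setI R n (`|x| + e)%R (~` ball x e)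
  (open_closedC (ball_open x e)).
have gapK z : ([set z | (`|z| <= `|x| + e)%R] `&` ~` ball x e) z ->
    q0%:E < F z + (- dot eta z)%R%:E.
  move=> [_ /= zx]; have := unique_touch_gap (z := z) tx ux.
  by rewrite Fx; apply=> zE; apply: zx; rewrite zE; exact: ballxx.
have [a qa aK] := lsc_compact_gap (lsc_tilt (eta := eta) lF) cK gapK.
exists ((a - q0) / e)%R => [|z ez]; first by rewrite divr_gt0 // subr_gt0.
have zx0 : (0 < `|z - x|)%R by exact: lt_le_trans ez.
have := rF z; case Fz : (F z) => [c| |] // _; rewrite ?leey // lee_fin.
pose s := (e / `|z - x|)%R; pose zs := (s *: z + (1 - s) *: x)%R.
have s0 : (0 < s)%R by rewrite divr_gt0.
have s01 : (0 <= s <= 1)%R by rewrite ltW //= ler_pdivrMr // mul1r.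
have zsx : (zs - x = s *: (z - x))%R.
  by rewrite /zs scalerBl scale1r scalerBr -addrA addrAC subrr add0r.
have nzs : (`|zs - x| = e)%R by rewrite zsx normrZ gtr0_norm // divfK ?gt_eqF.
have := aK zs; rewrite -leeBlDr // -EFinB => azs.
have {}azs : (a - - dot eta zs)%R%:E <= F zs.
  apply: azs; split => /=.
    by rewrite -[zs](subrK x) (le_trans (ler_normD _ _)) // nzs addrC.
  by rewrite -ball_normE /= distrC nzs ltxx.
have := convex_onT cF (x := z) (y := x) (a := c) (b := r) _ _ s01.
rewrite Fz Fx !lexx => /(_ isT isT) /(le_trans azs); rewrite lee_fin => h.
have e_s : (s * ((a - q0) / e * `|z - x|) = a - q0)%R.
  by rewrite /s; field; rewrite !gt_eqF.
rewrite -(ler_pM2l s0) mulrDr e_s; move: h; rewrite /zs /q0 !dotE; lra.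
Qed.

End ConvexSegments.

Section Legendre.
Context {R : realType} {n : nat}.
Local Notation V := 'rV[R]_n.
Variable phi : V -> \bar R.
Hypotheses (phi_dgf : dgf phi) (phi_legendre : legendre phi).
Implicit Types (x y z u v w eta : V).
Local Notation phis := (conjugate phi).

Let phi_lsc : lower_semicontinuous phi. Proof. by case: phi_dgf. Qed.
Let phi_convex : convex_on setT phi. Proof. by case: phi_dgf. Qed.

Lemma dgf_edom : exists y, phi y < +oo.
Proof. by case: phi_dgf => _ _ _ [y /intdom_edom]; exists y. Qed.

Lemma dgf_fin y : edom phi y -> phi y \is a fin_num.
Proof.
case: phi_dgf => -[_ h] _ _ _ _ yX; rewrite fin_numElt yX andbT ltNye.
exact: h.
Qed.

Lemma dgf_has_grad y : intdom phi y -> has_grad (fine \o phi) y (grad phi y).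
Proof.
by case: phi_dgf => _ _ _ _ h /h[_ d]; exact: differentiable_has_grad.
Qed.

Lemma grad_touch y : intdom phi y -> touch phi y (grad phi y).
Proof.
move=> Yy; have Xy := intdom_edom Yy.
apply/touchP; exists (fine (phi y)); first by rewrite fineK // dgf_fin.
move=> z; have [Xz|Xz] := pselect (phi z < +oo); last first.
  by move/negP: Xz; rewrite -leNgt leye_eq => /eqP ->; rewrite leey.
rewrite -[phi z]fineK ?dgf_fin // lee_fin.
apply: convex_has_grad_le (dgf_has_grad Yy) _ => t /andP[t0 t1].
have t01 : (0 <= t <= 1)%R by rewrite !ltW.
have -> : (y + t *: (z - y) = t *: z + (1 - t) *: y)%R.
  by rewrite scalerBl scale1r scalerBr addrCA addrA.
have := convex_onT phi_convex (x := z) (y := y) (a := fine (phi z))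
  (b := fine (phi y)) _ _ t01.
rewrite !fineK ?dgf_fin // => /(_ (lexx _) (lexx _)).
rewrite -[X in X <= _]fineK ?dgf_fin //; last exact: edom_convex.
by rewrite lee_fin /=; lra.
Qed.

Lemma touch_grad y eta : intdom phi y -> touch phi y eta -> eta = grad phi y.
Proof.
move=> Yy /touchP[r py h]; apply: has_grad_lower_unique (dgf_has_grad Yy) _.
move=> e e0; apply: filterS (nbhs_intdom Yy) => z /intdom_edom Xz.
have := h z; rewrite -[phi z]fineK ?dgf_fin // lee_fin /= py /=.
by have := mulr_ge0 (ltW e0) (normr_ge0 (z - y)%R); lra.
Qed.

(** A subgradient [eta] at a boundary point [x] would bound the gradients along
    the segment from an interior point [y] to [x]: by monotonicity they satisfy
    [<grad, y - x> >= <eta, y - x>], and [minorant_bound] at [y] converts such a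
    one-sided bound into a bound on the norm. Essential smoothness forbids this. *)
Lemma touch_intdom x eta : touch phi x eta -> intdom phi x.
Proof.
move=> /touchP[r px h]; apply: contrapT => nYx.
have [_ _ _ [y Yy] _] := phi_dgf; have [[_ _ smooth] _] := phi_legendre.
have Xx : edom phi x by rewrite /edom /= px ltry.
have [d d0 [C dC]] := minorant_bound Yy.
pose xk (k : nat) := (k.+1%:R^-1 *: y + (1 - k.+1%:R^-1) *: x)%R : V.
have k01 k : (0 < (k.+1%:R^-1 : R) <= 1)%R.
  by rewrite invr_gt0 ltr0n invf_le1 ?ltr0n // ler1n.
have Yk k : intdom phi (xk k) by apply: intdom_segment.
have xkE k : (xk k = x + k.+1%:R^-1 *: (y - x))%R.
  by rewrite /xk scalerBl scale1r scalerBr addrCA addrA.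
have xk_x : xk @ \oo --> x.
  rewrite (_ : xk = fun k => x + harmonic k *: (y - x))%R; last exact/funext.
  rewrite -[X in _ --> X]addr0 -[X in (x + X)%R](scale0r (y - x)%R).
  by apply: cvgD; [exact: cvg_cst|apply: cvgZr_tmp; exact: cvg_harmonic].
have /cvgryPgt := smooth xk x Yk xk_x (conj (subset_closure Xx) nYx).
move=> /(_ (n.+1%:R * ((C - r - dot eta (y - x)) / d))%R)/filter_ex[k].
rewrite ltNge => /negP; apply; apply: (le_trans (enorm_le_norm _)).
rewrite ler_wpM2l // ler_pdivlMr // mulrC.
set g := grad phi (xk k); have := k01 k; have := xkE k.
set t := (k.+1%:R^-1)%R => xkt /andP[t0 t1].
have /touchP[s pk hk] := grad_touch (Yk k); rewrite -/g in hk.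
have h1 := hk x; have h2 := h (xk k); rewrite px lee_fin in h1.
rewrite pk lee_fin xkt in h2.
have {}dC := dC g (s - dot g (xk k))%R _.
have {}dC : (d * `|g| + dot g y + (s - dot g (xk k)) <= C)%R.
  by apply: dC => z; apply: le_trans (hk z); rewrite lee_fin dotBr; lra.
have mono : (t * dot eta (y - x) <= t * dot g (y - x))%R.
  by move: h1 h2; rewrite xkt !(dotBr, dotDr, dotZr); lra.
have mono' : (dot eta (y - x) <= dot g (y - x))%R by rewrite -(ler_pM2l t0).
have := @ler_wpM2l _ (1 - t)%R _ _ _ mono'; rewrite subr_ge0 => /(_ t1).
by move: h1 h2 dC mono; rewrite xkt !(dotBr, dotDr, dotZr); lra.
Qed.

Lemma touch_unique x1 x2 eta : touch phi x1 eta -> touch phi x2 eta -> x1 = x2.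
Proof.
move=> t1 t2; have Y1 := touch_intdom t1; have Y2 := touch_intdom t2.
apply/eqP; apply: contrapT => /negP x12.
have [_ strict] := phi_legendre.
have /(_ x1 x2 (2^-1)%R Y1 Y2 x12) : strictly_convex_on (intdom phi) phi.
  apply: strict => [y Yy|]; last first.
    by apply/convex_setP => x y t Yx Yy t01; exact: intdom_convex.
  by exists (grad phi y); have [] := grad_touch Yy.
rewrite invr_gt0 ltr0n invf_lt1 ?ltr1n // => /(_ isT).
have /touchP[r1 -> h1] := t1; have /touchP[r2 -> h2] := t2.
set m := (_ + _)%R; have := h1 m; have := h2 m.
case: (phi m) => [s| |] //; rewrite !lee_fin lte_fin /m => a b.
by move: a b; rewrite !(dotBr, dotDr, dotZr); lra.
Qed.

Lemma grad_intdom y : intdom phi y -> intdom phis (grad phi y).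
Proof.
move=> Yy; have ty := grad_touch Yy; apply: (sharp_intdom ty).
by apply: convex_unique_touch_sharp => // x' tx'; exact: touch_unique tx' ty.
Qed.

Lemma conjugate_intdom_nonempty : intdom phis !=set0.
Proof.
by case: phi_dgf => _ _ _ [y Yy] _; exists (grad phi y); exact: grad_intdom.
Qed.

Lemma dgf_conjugate_fin eta : intdom phis eta -> phis eta \is a fin_num.
Proof. by have [y0 Xy0] := dgf_edom; exact: conjugate_fin Xy0. Qed.

Lemma dgf_conjugate_grad eta : intdom phis eta ->
  touch phi (grad phis eta) eta /\
  has_grad (fine \o phis) eta (grad phis eta).
Proof.
move=> Ye; have [y0 Xy0] := dgf_edom; have [x tx] := touch_exists phi_lsc Xy0 Ye.
have hx := conjugate_has_grad phi_lsc Xy0 Ye tx (fun x' t => touch_unique t tx).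
by have [_ ->] := has_grad_differentiable hx.
Qed.

Lemma conjugate_grad_touch eta : intdom phis eta -> touch phi (grad phis eta) eta.
Proof. by move=> /dgf_conjugate_grad[]. Qed.

Lemma dgf_conjugate_has_grad eta : intdom phis eta ->
  has_grad (fine \o phis) eta (grad phis eta).
Proof. by move=> /dgf_conjugate_grad[]. Qed.

Lemma conjugate_grad_intdom eta : intdom phis eta -> intdom phi (grad phis eta).
Proof. by move=> /conjugate_grad_touch/touch_intdom. Qed.

Lemma conjugate_gradK eta : intdom phis eta -> grad phi (grad phis eta) = eta.
Proof.
move=> Ye; apply/esym/touch_grad; first exact: conjugate_grad_intdom.
exact: conjugate_grad_touch.
Qed.

Lemma grad_conjugateK y : intdom phi y -> grad phis (grad phi y) = y.
Proof.
move=> Yy; apply: touch_unique (grad_touch Yy).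
exact/conjugate_grad_touch/grad_intdom.
Qed.

(** Fenchel-Moreau, with slopes restricted to the interior of the domain of the
    conjugate: the resolvents of [phi] only produce such slopes. *)
Lemma conjugate_dual_le w (c : R) :
  (forall eta, intdom phis eta -> (dot eta w - fine (phis eta) <= c)%R) ->
  phi w <= c%:E.
Proof.
move=> h; have [_ _ _ [y Yy] _] := phi_dgf; have Xy := intdom_edom Yy.
have /touchP[r py hy] := grad_touch Yy.
have minor z : (dot (grad phi y) z + (r - dot (grad phi y) y))%R%:E <= phi z.
  by apply: le_trans (hy z); rewrite lee_fin dotBr; lra.
apply: (le_of_resolvents phi_lsc minor) => e e0.
have ei0 : (0 < e^-1)%R by rewrite invr_gt0.
have [x tx] := resolvent_exists w phi_lsc phi_convex Xy minor ei0.
exists x, (e^-1 *: (w - x))%R; split => //.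
  by rewrite scalerA divff ?gt_eqF // scale1r addrC subrK.
have Yx := touch_intdom tx.
have := h _ (grad_intdom Yx); rewrite -(touch_grad Yx tx).
by rewrite (conjugate_touch tx) /= dotBr; lra.
Qed.

End Legendre.

(** * The proximal problem as a tilted minimization *)

Section ProximalObjective.
Context {R : realType} {n : nat}.
Local Notation V := 'rV[R]_n.
Variables (phi f : V -> \bar R) (lambda : R).
Hypotheses (phi_dgf : dgf phi) (phi_legendre : legendre phi).
Hypotheses (f_proper : proper_on (edom phi) f) (f_lsc : lsc_on (edom phi) f).
Hypotheses (lambda_gt0 : (0 < lambda)%R).
Hypothesis lambda_lt : lambda%:E < prox_threshold phi f.
Implicit Types (x y z u v w eta : V).
Local Notation phis := (conjugate phi).

Definition prox_objective x : \bar R :=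
  lambda%:E * patch (fun=> +oo) (edom phi) f x + phi x.
Local Notation g := prox_objective.
Local Notation gs := (conjugate prox_objective).

Lemma prox_objective_in x : edom phi x -> g x = lambda%:E * f x + phi x.
Proof. by move=> Xx; rewrite /prox_objective patchT // inE. Qed.

Lemma prox_objective_out x : ~ edom phi x -> g x = +oo.
Proof.
move=> Xx; rewrite /prox_objective patchN ?notin_setE //.
rewrite gt0_muley ?lte_fin // addye //.
by case: phi_dgf => -[_ h] _ _ _ _; exact: h.
Qed.

Lemma prox_objective_fin_edom x : g x < +oo -> edom phi x.
Proof.
by move=> gx; apply: contrapT => /prox_objective_out gE; rewrite gE ltxx in gx.
Qed.

Lemma prox_objective_edom : exists x, g x < +oo.
Proof.
case: f_proper => -[x Xx fx] fNy; exists x; rewrite prox_objective_in //.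
rewrite -[phi x]fineK ?dgf_fin //.
by move: fx (fNy x Xx); case: (f x) => [s| |] // _ _; rewrite ltry.
Qed.

(** Below the threshold a positive fraction of [phi] is left over once [f] has
    been compensated; it dominates [f] near the points outside the domain of
    [phi], where nothing is assumed on [f]. *)
Lemma prox_objective_minorant : exists2 k : R, (0 < k)%R &
  exists v (b : R), forall x, (dot v x + b)%R%:E + k%:E * phi x <= g x.
Proof.
have /ereal_sup_gt[_ [l' [l'0 [y Yy lb]] <-]] := lambda_lt; rewrite lte_fin => ll'.
have [c cl] : exists c : R, c%:E <= env phi l' f y.
  move: lb; case: (env _ _ _ _) => [c| |] // _; first by exists c.
  by exists 0%R; rewrite leey.
pose th := (lambda / l')%R.
have th1 : (0 < 1 - th)%R by rewrite subr_gt0 ltr_pdivrMr // mul1r.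
exists (1 - th)%R => //; exists (th *: grad phi y)%R.
exists (lambda * c + th * (fine (phi y) - dot (grad phi y) y))%R => x.
have [Xx|Xx] := pselect (edom phi x); last by rewrite prox_objective_out // leey.
rewrite prox_objective_in //.
have : c%:E <= f x + (l'^-1)%:E * bregman phi x y.
  by apply: le_trans cl _; apply: ereal_inf_lbound; exists x.
rewrite /bregman mem_set // -[phi x]fineK ?dgf_fin //.
have Xy := intdom_edom Yy; rewrite -[phi y]fineK ?dgf_fin //=.
case: f_proper => _ /(_ x Xx); case: (f x) => [s| |] // _; last first.
  by move=> _; rewrite gt0_muley ?lte_fin // addye // leey.
rewrite !lee_fin dotZl dotBr => /(ler_wpM2l (ltW lambda_gt0)).
by rewrite mulrDr mulrA -/th; lra.
Qed.

Lemma prox_objective_affine_minorant :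
  exists v (b : R), forall x, (dot v x + b)%R%:E <= g x.
Proof.
have [k k0 [v [b gvb]]] := prox_objective_minorant.
have [_ _ _ [y Yy] _] := phi_dgf; have /touchP[r py hy] := grad_touch phi_dgf Yy.
exists (v + k *: grad phi y)%R, (b + k * (r - dot (grad phi y) y))%R => x.
apply: le_trans (gvb x); have := hy x.
case: (phi x) => [p| |] //; last first.
  by move=> _; rewrite gt0_muley ?lte_fin // addey // leey.
rewrite !lee_fin dotDl dotZl dotBr => /(ler_wpM2l (ltW k0)); lra.
Qed.

Lemma prox_objective_lsc : lower_semicontinuous g.
Proof.
have [k k0 [v [b gvb]]] := prox_objective_minorant.
have [_ phi_lsc _ _ _] := phi_dgf.
move=> x a; have [Xx|Xx] := pselect (edom phi x); last first.
  move=> _; have px : phi x = +oo.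
    by apply/eqP; rewrite -leye_eq leNgt; exact/negP.
  pose M := ((a - (dot v x + b) + 1) / k)%R.
  have [|U Ux UM] := phi_lsc x M; first by rewrite px ltry.
  have /(@cvgrPdist_lt _ _ _ (nbhs x))/(_ _ ltr01) := @dot_continuous _ _ v x.
  move=> vx; exists (U `&` [set z | (dot v x - 1 < dot v z)%R]).
    apply: filterI => //; apply: filterS vx => z.
    by rewrite ltr_norml /= => /andP[_ h]; lra.
  move=> z [/UM Mz /= vz]; apply: lt_le_trans (gvb z).
  move: Mz; case: (phi z) => [p| |] //; last first.
    by move=> _; rewrite gt0_muley ?lte_fin // addey // ltry.
  by rewrite !lte_fin /M ltr_pdivrMr //; lra.
rewrite prox_objective_in // -[phi x]fineK ?dgf_fin //; set p := fine (phi x).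
rewrite -lteBlDr // -EFinB => h.
have [s aps sf] : exists2 s : R, ((a - p) / lambda < s)%R & s%:E < f x.
  apply: ereal_dense; case: f_proper => _ /(_ x Xx).
  move: h; case: (f x) => [s| |] // h _; last by rewrite ltry.
  by rewrite lte_fin ltr_pdivrMr // mulrC -lte_fin.
move: aps; rewrite ltr_pdivrMr // => aps.
have [|U Ux UM] := phi_lsc x (a - lambda * s)%R.
  by rewrite -[phi x]fineK ?dgf_fin // lte_fin -/p; lra.
have fs := f_lsc Xx sf.
exists (U `&` [set z | edom phi z -> s%:E < f z]); first exact: filterI.
move=> z [/UM pz /= fz]; have [Xz|Xz] := pselect (edom phi z); last first.
  by rewrite prox_objective_out // ltry.
rewrite prox_objective_in //; move: pz; rewrite -[phi z]fineK ?dgf_fin //.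
move: (fz Xz); case: (f z) => [q| |] //; last first.
  by move=> _ _; rewrite gt0_muley ?lte_fin // addye // ltry.
by rewrite !lte_fin -(ltr_pM2l lambda_gt0); lra.
Qed.

(** Everything rests on this identity: up to scaling and a constant, the
    objective of the proximal problem at [y] is [g] tilted by the slope
    [grad phi y]. *)
Lemma prox_criterionE x y : intdom phi y -> edom phi x ->
  f x + (lambda^-1)%:E * bregman phi x y =
  (lambda^-1)%:E *
    (g x + (dot (grad phi y) y - fine (phi y) - dot (grad phi y) x)%R%:E).
Proof.
move=> Yy Xx; have Xy := intdom_edom Yy.
rewrite prox_objective_in // /bregman mem_set //.
rewrite -[phi x]fineK ?dgf_fin // -[phi y]fineK ?dgf_fin //=.
have li0 : (0 < lambda^-1)%R by rewrite invr_gt0.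
case: f_proper => _ /(_ x Xx); case: (f x) => [s| |] // _; last first.
  by rewrite gt0_muley ?lte_fin // !addye // gt0_muley ?lte_fin.
by congr (_%:E); rewrite dotBr; field; rewrite gt_eqF.
Qed.

Lemma proxP x y : intdom phi y ->
  prox phi lambda f y x <-> touch g x (grad phi y).
Proof.
move=> Yy; have li0 : (0 < lambda^-1)%R by rewrite invr_gt0.
set k := (dot (grad phi y) y - fine (phi y))%R.
have leP x' z : ((lambda^-1)%:E * (g x' + (k - dot (grad phi y) x')%R%:E) <=
    (lambda^-1)%:E * (g z + (k - dot (grad phi y) z)%R%:E)) =
    (g x' + (k - dot (grad phi y) x')%R%:E <= g z + (k - dot (grad phi y) z)%R%:E).
  by rewrite lee_pmul2l // lte_fin.
split=> [[_ Xx min]|tx].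
  have {}min z : g x + (k - dot (grad phi y) x)%R%:E <=
      g z + (k - dot (grad phi y) z)%R%:E.
    have [Xz|Xz] := pselect (edom phi z); last first.
      by rewrite (prox_objective_out Xz) addye // leey.
    by rewrite -leP -!prox_criterionE //; exact: min.
  have [x0 gx0] := prox_objective_edom.
  have [v [b gvb]] := prox_objective_affine_minorant.
  have [r gx] : exists r : R, g x = r%:E.
    have := gvb x; have := min x0; move: gx0.
    by case: (g x0) => [s| |] // _; case: (g x) => [r| |] // _ _; exists r.
  apply/touchP; exists r => // z; have := min z; rewrite gx -EFinD.
  rewrite -leeBlDr // -EFinB; apply: le_trans.
  by rewrite lee_fin dotBr; lra.
have [gx sx] := tx; have gxy : g x < +oo by move: gx; rewrite fin_numElt => /andP[].
have Xx := prox_objective_fin_edom gxy; split => // z Xz.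
rewrite !prox_criterionE // leP; have /touchP[r -> h] := tx.
rewrite -EFinD -leeBlDr // -EFinB; apply: le_trans (h z).
by rewrite lee_fin dotBr; lra.
Qed.

Local Notation h := (fun eta => env phi lambda f (grad phis eta)).

Lemma env_geP eta (c : R) : intdom phis eta ->
  c%:E <= h eta <-> gs eta <= (fine (phis eta) - lambda * c)%R%:E.
Proof.
move=> Ye; have Yy := conjugate_grad_intdom phi_dgf phi_legendre Ye.
have ty := conjugate_grad_touch phi_dgf phi_legendre Ye.
have li0 : (0 < lambda^-1)%R by rewrite invr_gt0.
have e x : edom phi x ->
    (c%:E <= f x + (lambda^-1)%:E * bregman phi x (grad phis eta)) =
    ((dot eta x - (fine (phis eta) - lambda * c))%R%:E <= g x).
  move=> Xx; rewrite prox_criterionE // (conjugate_touch ty) /=.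
  rewrite (conjugate_gradK phi_dgf phi_legendre Ye) lee_pdivlMl //.
  rewrite -leeBlDr // -EFinM -EFinB; congr (_%:E <= _); lra.
split=> [hc|/conjugate_leP gc].
  apply/conjugate_leP => x; have [Xx|Xx] := pselect (edom phi x); last first.
    by rewrite prox_objective_out // leey.
  by rewrite -e //; apply: le_trans hc _; apply: ereal_inf_lbound; exists x.
by apply: le_ereal_inf_tmp => _ [x Xx <-]; rewrite e.
Qed.

Definition dual_gap eta : R := (fine (phis eta) - fine (gs eta))%R.

Lemma envE eta : intdom phis eta -> gs eta \is a fin_num ->
  h eta = (lambda^-1 * dual_gap eta)%R%:E.
Proof.
move=> Ye gfin; apply/eqP; rewrite eq_le; apply/andP; split.
  rewrite leNgt; apply/negP => /ereal_dense[c lc /ltW/(env_geP c Ye)].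
  rewrite -(fineK gfin) lee_fin leNgt => /negP; apply.
  by move: lc; rewrite mulrC ltr_pdivrMr // /dual_gap; lra.
apply/(env_geP _ Ye); rewrite -[X in X <= _](fineK gfin) lee_fin.
by rewrite mulrA divff ?gt_eqF // mul1r /dual_gap; lra.
Qed.

Lemma env_gtNy eta : intdom phis eta -> -oo < h eta -> gs eta \is a fin_num.
Proof.
move=> Ye hN; have [x0 gx0] := prox_objective_edom.
rewrite fin_numElt (conjugate_gtNy _ gx0) /=.
have [c ch] : exists c : R, c%:E <= h eta.
  move: hN; case: (h eta) => [c| |] // _; first by exists c.
  by exists 0%R; rewrite leey.
by move/(env_geP c Ye): ch => /le_lt_trans; apply; rewrite ltry.
Qed.

End ProximalObjective.

(** * Convexity of the dual gap and differentiability of the envelope *)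

Section GradientContinuity.
Context {R : realType} {n : nat}.
Local Notation V := 'rV[R]_n.
Implicit Types (F G : V -> \bar R) (x y z u v w eta : V).

(** Under uniqueness the gradient of the conjugate is the touching point, and
    touching points move continuously with the slope. *)
Lemma conjugate_grad_near G x0 x eta (e : R) : lower_semicontinuous G ->
  G x0 < +oo ->
  (forall eta' x1 x2, intdom (conjugate G) eta' ->
    touch G x1 eta' -> touch G x2 eta' -> x1 = x2) ->
  intdom (conjugate G) eta -> touch G x eta -> (0 < e)%R ->
  \forall eta' \near eta, (`|grad (conjugate G) eta' - x| < e)%R.
Proof.
move=> lG G0 uG Ge tx e0.
have ux x' (t' : touch G x' eta) : x' = x := uG _ _ _ Ge t' tx.
have near_x := sharp_near tx (unique_touch_sharp lG Ge tx ux) e0.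
apply: filterS2 (nbhs_intdom Ge) near_x => eta' Ge' near_x.
have [x' tx'] := touch_exists lG G0 Ge'.
have := conjugate_has_grad lG G0 Ge' tx' (fun z tz => uG _ _ _ Ge' tz tx').
by move=> /has_grad_differentiable[_ ->]; exact: near_x.
Qed.

End GradientContinuity.

Section Equivalences.
Context {R : realType} {n : nat}.
Local Notation V := 'rV[R]_n.
Variables (phi f : V -> \bar R) (lambda : R).
Hypotheses (phi_dgf : dgf phi) (phi_legendre : legendre phi).
Hypotheses (f_proper : proper_on (edom phi) f) (f_lsc : lsc_on (edom phi) f).
Hypotheses (lambda_gt0 : (0 < lambda)%R).
Hypothesis lambda_lt : lambda%:E < prox_threshold phi f.
Implicit Types (x y z u v w eta : V).
Local Notation phis := (conjugate phi).
Local Notation Y := (intdom phi).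
Local Notation Ys := (intdom phis).
Local Notation P := (prox phi lambda f).
Local Notation g := (prox_objective phi f lambda).
Local Notation gs := (conjugate g).
Local Notation psi := (dual_gap phi f lambda).
Local Notation h := (fun eta => env phi lambda f (grad phis eta)).

Let g_lsc : lower_semicontinuous g.
Proof. exact: prox_objective_lsc. Qed.

(** The common content of conditions (a) to (d). *)
Definition gap_convex :=
  (forall eta, Ys eta -> gs eta \is a fin_num) /\
  (forall eta1 eta2 (t : R), Ys eta1 -> Ys eta2 -> (0 <= t <= 1)%R ->
    (psi (t *: eta1 + (1 - t) *: eta2) <=
     t * psi eta1 + (1 - t) * psi eta2)%R).

Lemma conjugate_intdom_convex eta1 eta2 (t : R) :
  Ys eta1 -> Ys eta2 -> (0 <= t <= 1)%R ->
  Ys (t *: eta1 + (1 - t) *: eta2)%R.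
Proof. by move=> *; apply: intdom_convex => //; exact: conjugate_convex. Qed.

Lemma env_convexP : (forall eta, Ys eta -> gs eta \is a fin_num) ->
  convex_on Ys h <-> gap_convex.
Proof.
move=> gfin; have li0 : (0 < lambda^-1)%R by rewrite invr_gt0.
rewrite (convex_on_fineP (psi := fun eta => lambda^-1 * psi eta)%R); last 2 first.
- exact: conjugate_intdom_convex.
- by move=> eta Ye; rewrite envE //; exact: gfin.
split=> [c|[_ c] eta1 eta2 t Y1 Y2 t01]; last first.
  by have := ler_wpM2l (ltW li0) (c _ _ _ Y1 Y2 t01); lra.
split => // eta1 eta2 t Y1 Y2 t01; rewrite -(ler_pM2l li0).
by have := c _ _ _ Y1 Y2 t01; lra.
Qed.

Lemma proper_convex_envP :
  (proper_on Ys h /\ convex_on Ys h) <-> gap_convex.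
Proof.
split=> [[[_ hN] ch]|gc].
  apply/env_convexP => // eta Ye; apply: env_gtNy => //.
  by rewrite ltNye; exact: hN.
have [gfin _] := gc; split; last exact/env_convexP.
split=> [|eta Ye]; last by rewrite envE //; exact: gfin.
have [eta Ye] := conjugate_intdom_nonempty phi_dgf phi_legendre.
by exists eta => //; rewrite envE //; exact: gfin.
Qed.

Lemma convex_fine_le F eta1 eta2 (t : R) : convex_on setT F ->
  (forall eta, Ys eta -> F eta \is a fin_num) -> Ys eta1 -> Ys eta2 ->
  (0 <= t <= 1)%R ->
  (fine (F (t *: eta1 + (1 - t) *: eta2)) <=
   t * fine (F eta1) + (1 - t) * fine (F eta2))%R.
Proof.
move=> cF Ffin Y1 Y2 t01; rewrite -lee_fin fineK; last first.
  by apply: Ffin; exact: conjugate_intdom_convex.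
by apply: convex_onT => //; rewrite fineK // Ffin.
Qed.

Lemma B_smooth_conjugateP : B_smooth phis gs <-> gap_convex.
Proof.
have fE eta : Ys eta -> gs eta \is a fin_num ->
    - gs eta + phis eta = (psi eta)%:E.
  move=> Ye; have := dgf_conjugate_fin phi_dgf Ye.
  rewrite /dual_gap; case: (gs eta) => [a| |]; case: (phis eta) => [b| |] //.
  by move=> _ _ /=; congr (_%:E); rewrite addrC.
split=> [[gfin _ c]|[gfin c]].
  split=> //; apply/(convex_on_fineP (F := fun eta => - gs eta + phis eta)).
  - exact: conjugate_intdom_convex.
  - by move=> eta Ye; rewrite fE //; exact: gfin.
  exact: c.
split => //; last first.
  apply/(convex_on_fineP (psi := psi)) => //; first exact: conjugate_intdom_convex.
  by move=> eta Ye; rewrite fE //; exact: gfin.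
apply/(convex_on_fineP (psi := fun eta => fine (gs eta) + fine (phis eta))%R).
- exact: conjugate_intdom_convex.
- move=> eta Ye; rewrite EFinD !fineK //; last exact: gfin.
  exact: dgf_conjugate_fin.
move=> eta1 eta2 t Y1 Y2 t01.
have := convex_fine_le (@conjugate_convex _ _ g) gfin Y1 Y2 t01.
have := convex_fine_le (@conjugate_convex _ _ phi)
  (fun eta => @dgf_conjugate_fin _ _ _ phi_dgf eta) Y1 Y2 t01.
lra.
Qed.

Lemma B_smooth_envP :
  (convex_on Ys (fun eta => lambda%:E * h eta) /\
   B_smooth phis (fun eta => lambda%:E * h eta)) <-> gap_convex.
Proof.
have hE eta : Ys eta -> gs eta \is a fin_num ->
    lambda%:E * h eta = (psi eta)%:E.
  by move=> Ye gfin; rewrite envE // -EFinM mulrA divff ?gt_eqF // mul1r.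
split=> [[c [hfin _ _]]|[gfin c]].
  have gfin eta : Ys eta -> gs eta \is a fin_num.
    move=> Ye; apply: env_gtNy => //; have := hfin _ Ye; rewrite ltNye.
    by apply: contraTneq => ->; rewrite gt0_muleNy ?lte_fin.
  split=> //; apply/(convex_on_fineP (F := fun eta => lambda%:E * h eta)).
  - exact: conjugate_intdom_convex.
  - by move=> eta Ye; rewrite hE //; exact: gfin.
  exact: c.
have phisE eta : Ys eta -> phis eta = (fine (phis eta))%:E.
  by move=> Ye; rewrite fineK //; exact: dgf_conjugate_fin.
split.
  apply/(convex_on_fineP (psi := psi)) => //; first exact: conjugate_intdom_convex.
  by move=> eta Ye; rewrite hE //; exact: gfin.
split=> [eta Ye||]; first by rewrite hE //; exact: gfin.
  apply/(convex_on_fineP (psi := fun eta => psi eta + fine (phis eta))%R).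
  - exact: conjugate_intdom_convex.
  - by move=> eta Ye; rewrite hE ?EFinD -?phisE //; exact: gfin.
  move=> eta1 eta2 t Y1 Y2 t01; have := c _ _ _ Y1 Y2 t01.
  have := convex_fine_le (@conjugate_convex _ _ phi)
    (fun eta => @dgf_conjugate_fin _ _ _ phi_dgf eta) Y1 Y2 t01.
  lra.
apply/(convex_on_fineP (psi := fun eta => fine (gs eta))).
- exact: conjugate_intdom_convex.
- move=> eta Ye; rewrite hE; [|by []|exact: gfin].
  by rewrite (phisE _ Ye) -EFinN -EFinD; congr (_%:E); rewrite /dual_gap; lra.
by move=> eta1 eta2 t; exact: convex_fine_le (@conjugate_convex _ _ g) gfin.
Qed.

Lemma C1_env_gap_convex : convex_on Ys h /\ C1_on Ys h -> gap_convex.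
Proof.
move=> [c [d _]]; apply/env_convexP => // eta Ye; apply: env_gtNy => //.
have [/nbhs_singleton hfin _] := d _ Ye.
by move: hfin; rewrite fin_numElt => /andP[].
Qed.

Section GapConvex.
Hypothesis gapC : gap_convex.

Lemma conjugate_objective_intdom eta : Ys eta -> intdom gs eta.
Proof.
move=> /nbhs_intdom; apply: filterS => z Yz; have [/(_ _ Yz)] := gapC.
by rewrite fin_numElt => /andP[].
Qed.

(** The increment of the gap at [eta] is bounded above by the differentiable
    increment of the conjugate of [phi] minus a linear term, since a touching
    point is a subgradient of the conjugate of [g].  A convex function with such
    an upper bound is differentiable: reflect [z] through [eta]. *)
Lemma gap_has_grad x eta : Ys eta -> touch g x eta ->
  has_grad psi eta (grad phis eta - x)%R.
Proof.
move=> Ye tx e e0; have [gfin c] := gapC.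
have := dgf_conjugate_has_grad phi_dgf phi_legendre Ye e0.
move=> /filterI/(_ (nbhs_intdom Ye))/nbhs_ballP[r /= r0 rP].
apply/nbhs_ballP; exists r => //= z zr.
have upper z' : ball eta r z' ->
    (psi z' - psi eta - dot (grad phis eta - x) (z' - eta) <=
     e * `|z' - eta|)%R.
  move=> /rP[/ler_normlW h1 Yz']; apply: le_trans h1 => /=.
  have := conjugate_touch_le z' tx; rewrite -[X in _ <= X]fineK ?gfin // lee_fin.
  by rewrite /dual_gap !dotBl !dotBr (dotC x z') (dotC x eta); lra.
pose z' := (eta - (z - eta))%R.
have zr' : ball eta r z'.
  by move: zr; rewrite -!ball_normE /= /z' subKr distrC.
have zz' : (z' - eta = - (z - eta))%R by rewrite /z' addrC addKr.
have [_ Yz] := rP _ zr; have [_ Yz'] := rP _ zr'.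
have := upper _ zr; have := upper _ zr'; rewrite zz' normrN dotNr => h1 h2.
have half01 : (0 <= (2^-1 : R) <= 1)%R by rewrite invr_ge0 ler0n invf_le1 // ler1n.
have := c z z' (2^-1)%R Yz Yz' half01.
have -> : (2^-1 *: z + (1 - 2^-1) *: z' = eta)%R.
  have -> : (1 - 2^-1 = 2^-1 :> R)%R by lra.
  rewrite -scalerDr /z' addrCA subKr (_ : eta + eta = 2%:R *: eta)%R.
    by rewrite scalerA mulVf ?scale1r // pnatr_eq0.
  by rewrite scaler_nat mulr2n.
by move=> h3; rewrite ler_norml; apply/andP; split; lra.
Qed.

Lemma objective_touch_exists eta : Ys eta -> exists x, touch g x eta.
Proof.
move=> /conjugate_objective_intdom.
have [x0 gx0] := prox_objective_edom lambda phi_dgf f_proper.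
exact: touch_exists gx0.
Qed.

Lemma objective_touch_unique eta x1 x2 : Ys eta ->
  touch g x1 eta -> touch g x2 eta -> x1 = x2.
Proof.
move=> Ye t1 t2.
have /addrI/oppr_inj := has_grad_unique (gap_has_grad Ye t2) (gap_has_grad Ye t1).
by [].
Qed.

Lemma objective_grad_touch eta : Ys eta -> touch g (grad gs eta) eta.
Proof.
move=> Ye; have [x0 gx0] := prox_objective_edom lambda phi_dgf f_proper.
have [x tx] := objective_touch_exists Ye.
have := conjugate_has_grad g_lsc gx0 (conjugate_objective_intdom Ye) tx
  (fun z tz => objective_touch_unique Ye tz tx).
by move=> /has_grad_differentiable[_ ->].
Qed.

Definition prox_map y := grad gs (grad phi y).

Lemma prox_single_valued : single_valued_on Y P prox_map.
Proof.
move=> y Yy; have Ye := grad_intdom phi_dgf phi_legendre Yy.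
have tT := objective_grad_touch Ye; apply/seteqP; split=> x /=.
  move=> Pyx; apply: (objective_touch_unique Ye _ tT).
  exact/(proxP phi_dgf f_proper lambda_gt0 lambda_lt x Yy).
by move=> ->; apply/proxP.
Qed.

Lemma env_has_grad eta : Ys eta ->
  has_grad (fine \o h) eta (lambda^-1 *: (grad phis eta - grad gs eta)).
Proof.
move=> Ye; have [gfin _] := gapC; have li0 : (0 < lambda^-1)%R by rewrite invr_gt0.
apply: has_grad_near (has_gradZ li0 (gap_has_grad Ye (objective_grad_touch Ye))).
by apply: filterS (nbhs_intdom Ye) => z Yz; rewrite /= envE //; exact: gfin.
Qed.

Lemma env_grad eta : Ys eta ->
  grad h eta = (lambda^-1 *: (grad phis eta - prox_map (grad phis eta)))%R.
Proof.
move=> Ye; rewrite /prox_map conjugate_gradK //.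
by have [_ ->] := has_grad_differentiable (env_has_grad Ye).
Qed.

Lemma env_grad_near eta (e : R) : Ys eta -> (0 < e)%R ->
  \forall z \near eta, (`|grad h eta - grad h z| < e)%R.
Proof.
move=> Ye e0; have [y0 py0] := dgf_edom phi_dgf.
have li0 : (0 < lambda^-1)%R by rewrite invr_gt0.
have [_ phi_lsc _ _ _] := phi_dgf.
have e'0 : (0 < e * lambda / 2)%R by rewrite divr_gt0 // mulr_gt0.
have near1 := conjugate_grad_near phi_lsc py0
  (fun eta' x1 x2 _ => @touch_unique _ _ _ phi_dgf phi_legendre x1 x2 eta')
  Ye (conjugate_grad_touch phi_dgf phi_legendre Ye) e'0.
have tT := objective_grad_touch Ye.
have near2 := sharp_near tT (unique_touch_sharp g_lsc
  (conjugate_objective_intdom Ye) tT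
  (fun z tz => objective_touch_unique Ye tz tT)) e'0.
apply: filterS3 (nbhs_intdom Ye) near1 near2 => z Yz n1 n2.
have [_ ->] := has_grad_differentiable (env_has_grad Ye).
have [_ ->] := has_grad_differentiable (env_has_grad Yz).
rewrite -scalerBr normrZ (gtr0_norm li0) mulrC ltr_pdivrMr //.
have {}n2 := n2 _ (objective_grad_touch Yz).
move: n1 n2; move: (grad phis eta) (grad gs eta) (grad phis z) (grad gs z).
move=> a b c d n1 n2.
have -> : (a - b - (c - d) = - (c - a) + (d - b))%R.
  by rewrite !opprB (addrACA a (- b)%R) (addrACA a (- c)%R) (addrC (- b)%R).
by apply: le_lt_trans (ler_normD _ _) _; rewrite normrN; lra.
Qed.

Lemma env_C1 : C1_on Ys h.
Proof.
have [gfin _] := gapC; split=> [eta Ye|].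
  split; last by have [] := has_grad_differentiable (env_has_grad Ye).
  by apply: filterS (nbhs_intdom Ye) => z Yz; rewrite envE //; exact: gfin.
rewrite continuous_open_subspace; last exact: open_interior.
move=> eta; rewrite inE => Ye; apply/(@cvgrPdist_lt _ _ _ (nbhs eta)) => e e0.
exact: env_grad_near.
Qed.

End GapConvex.

End Equivalences.

(** * Nonexpansiveness, monotonicity and weak convexity *)

Section Nonexpansiveness.
Context {R : realType} {n : nat}.
Local Notation V := 'rV[R]_n.
Variables (phi f : V -> \bar R) (lambda : R).
Hypotheses (phi_dgf : dgf phi) (phi_legendre : legendre phi).
Hypotheses (f_proper : proper_on (edom phi) f) (f_lsc : lsc_on (edom phi) f).
Hypotheses (lambda_gt0 : (0 < lambda)%R).
Hypothesis lambda_lt : lambda%:E < prox_threshold phi f.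
Implicit Types (x y z u v w eta : V).
Local Notation phis := (conjugate phi).
Local Notation Y := (intdom phi).
Local Notation Ys := (intdom phis).
Local Notation P := (prox phi lambda f).
Local Notation g := (prox_objective phi f lambda).
Local Notation gs := (conjugate g).
Local Notation psi := (dual_gap phi f lambda).
Local Notation T := (prox_map phi f lambda).

(** Both halves [psi] and [conjugate g] of [conjugate phi] lie above their
    tangents; the tangent of [psi] at the slope of [y] and that of [conjugate g]
    at the slope of [ybar] add up to an affine minorant of [conjugate phi] whose
    slope is [y - x + xbar]. *)
Lemma gap_exchange : gap_convex phi f lambda -> exists c : V -> V -> R,
  forall ybar xbar y x, Y ybar -> Y y ->
    touch g xbar (grad phi ybar) -> touch g x (grad phi y) ->
    phi (y - x + xbar)%R <= (fine (phi ybar) + c ybar xbar - c y x)%R%:E.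
Proof.
move=> gapC; have [gfin gcvx] := gapC.
(* the value at the origin of the tangent of [psi] at the slope of [y] *)
exists (fun y x => psi (grad phi y) - dot (y - x) (grad phi y))%R.
move=> ybar xbar y x Yb Yy tb ty.
have eb := grad_intdom phi_dgf phi_legendre Yb.
have ey := grad_intdom phi_dgf phi_legendre Yy.
apply: (conjugate_dual_le phi_dgf phi_legendre) => eta Ye.
have h1 : (psi (grad phi y) + dot (y - x) (eta - grad phi y) <= psi eta)%R.
  have := gap_has_grad phi_dgf phi_legendre gapC ey ty.
  rewrite grad_conjugateK // => hg.
  apply: (convex_has_grad_le hg) => t /andP[t0 t1].
  have t01 : (0 <= t <= 1)%R by rewrite !ltW.
  have := gcvx eta (grad phi y) t Ye ey t01.
  have -> : (t *: eta + (1 - t) *: grad phi y =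
      grad phi y + t *: (eta - grad phi y))%R.
    by rewrite scalerBl scale1r scalerBr addrCA addrA.
  by lra.
have h2 : (fine (gs (grad phi ybar)) + dot (eta - grad phi ybar) xbar <=
    fine (gs eta))%R.
  by rewrite -lee_fin (fineK (gfin _ Ye)); exact: (conjugate_touch_le eta tb).
have h3 : (fine (phis (grad phi ybar)) =
    dot (grad phi ybar) ybar - fine (phi ybar))%R.
  by rewrite (conjugate_touch (grad_touch phi_dgf Yb)).
move: h1 h2 h3; rewrite /dual_gap.
move: (grad phi ybar) (grad phi y) => slopeb slope.
rewrite (dotC (eta - slopeb)%R xbar) (dotC eta) (dotC slopeb ybar).
by rewrite !(dotBl, dotBr, dotDl); lra.
Qed.

Lemma prox_map_firmly_nonexpansive : gap_convex phi f lambda ->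
  a_firmly_nonexpansive phi T.
Proof.
move=> gapC.
have tT y : Y y -> touch g (T y) (grad phi y).
  move=> Yy; apply: objective_grad_touch => //; exact: grad_intdom.
split=> [y /tT[gT _]|yb y Yb Yy].
  apply: (@prox_objective_fin_edom _ _ _ f lambda) => //.
  by move: gT; rewrite fin_numElt => /andP[].
move: (tT yb Yb) (tT y Yy); move: (T yb) (T y) => xb x tb tx.
have [c exch] := gap_exchange gapC.
apply: le_trans (leeD (exch _ _ _ _ Yy Yb tx tb) (exch _ _ _ _ Yb Yy tb tx)) _.
rewrite -(fineK (dgf_fin phi_dgf (intdom_edom Yb))).
rewrite -(fineK (dgf_fin phi_dgf (intdom_edom Yy))).
by rewrite -!EFinD lee_fin /=; lra.
Qed.

Lemma bregman_symE y1 y2 : Y y1 -> Y y2 -> bregman_sym phi y1 y2 =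
  (dot (y1 - y2) (grad phi y1 - grad phi y2))%R%:E.
Proof.
move=> Y1 Y2; rewrite /bregman_sym /bregman !mem_set //.
rewrite -(fineK (dgf_fin phi_dgf (intdom_edom Y1))).
rewrite -(fineK (dgf_fin phi_dgf (intdom_edom Y2))) /=.
congr (_%:E); move: (grad phi y1) (grad phi y2) => a b.
by rewrite (dotC (y1 - y2)%R) !(dotBl, dotBr); lra.
Qed.

Lemma firmly_nonexpansive_monotone S :
  single_valued_on Y P S -> a_firmly_nonexpansive phi S ->
  set_dom P = Y /\
  forall y1 y2 x1 x2, Y y1 -> Y y2 -> P y1 x1 -> P y2 x2 ->
    (dot (x1 - x2)%R (grad phi y1 - grad phi y2)%R)%:E <= bregman_sym phi y1 y2.
Proof.
move=> PS [_ firm]; split.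
  apply/seteqP; split=> [y [x []] //|y Yy].
  by exists (S y); rewrite PS.
move=> y1 y2 x1 x2 Y1 Y2; rewrite !PS //= => -> ->.
have /touchP[r1 p1 h1] := grad_touch phi_dgf Y1.
have /touchP[r2 p2 h2] := grad_touch phi_dgf Y2.
have := firm y1 y2 Y1 Y2; rewrite p1 p2 => /(le_trans (leeD (h2 _) (h1 _))).
rewrite bregman_symE // -!EFinD !lee_fin.
move: (grad phi y1) (grad phi y2) => a b.
rewrite (dotC (S y1 - S y2)%R) (dotC (y1 - y2)%R).
by rewrite !(dotBl, dotBr, dotDr, dotNr); lra.
Qed.

(** [grad phis eta - x], with [x] touching at [eta], is the would-be gradient of
    the gap, and it is monotone. Over one step [d] the gap grows by at least
    [<y - x', d>], with [y] taken at the old and [x'] at the new slope; the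
    mismatch [<y - y', d>] telescopes when the steps are added. *)
Lemma gap_steps eta0 (d : V) x0 (k : nat) :
  (forall eta, Ys eta -> exists x, touch g x eta) ->
  (forall eta1 eta2 x1 x2, Ys eta1 -> Ys eta2 -> touch g x1 eta1 ->
    touch g x2 eta2 ->
    (dot (x1 - x2) (eta1 - eta2) <=
     dot (grad phis eta1 - grad phis eta2) (eta1 - eta2))%R) ->
  touch g x0 eta0 -> (forall j, (j <= k)%N -> Ys (eta0 + j%:R *: d)%R) ->
  (psi eta0 + k%:R * dot (grad phis eta0 - x0) d +
   dot (grad phis eta0 - grad phis (eta0 + k%:R *: d)) d <=
   psi (eta0 + k%:R *: d))%R.
Proof.
move=> ex mono t0; elim: k => [_|k IH Yd].
  by rewrite scale0r !addr0 subrr dot0l mul0r !addr0.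
have := Yd 0%N isT.
rewrite scale0r addr0 => Y0.
have pp' : (eta0 + k.+1%:R *: d = eta0 + k%:R *: d + d)%R.
  by rewrite -natr1 scalerDl scale1r addrA.
have p'0 : (eta0 + k.+1%:R *: d - eta0 = k.+1%:R *: d)%R by rewrite addrC addKr.
have [Yp Yp'] := (Yd k (leqnSn k), Yd k.+1 (leqnn _)).
move: pp' p'0 Yp Yp' {IH}(IH (fun j jk => Yd j (leqW jk))).
move: (eta0 + k%:R *: d)%R => p.
move: (eta0 + k.+1%:R *: d)%R => p' pp' p'0 Yp Yp' IH.
have [x1 t1] := ex _ Yp'; have [xk tk] := ex _ Yp.
have := mono _ _ _ _ Yp' Y0 t1 t0; rewrite p'0.
have := conjugate_touch_le p' (conjugate_grad_touch phi_dgf phi_legendre Yp).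
have := conjugate_touch_le p t1.
rewrite -[X in (_ <= X -> _)%E]fineK; last by rewrite (conjugate_touch tk).
rewrite -[X in (_ -> _ <= X -> _)%E]fineK; last exact: dgf_conjugate_fin.
rewrite !lee_fin; move: IH; rewrite /dual_gap.
have -> : (p - p' = - d)%R by rewrite pp' opprD addrA subrr add0r.
have -> : (p' - p = d)%R by rewrite pp' addrC addKr.
move: (grad phis eta0) (grad phis p) (grad phis p') => a b c.
rewrite !dotZr ler_pM2l ?ltr0Sn // dotNl -natr1 !(dotC d) !dotBl; lra.
Qed.

Lemma monotone_gap_convex : set_dom P = Y ->
  (forall y1 y2 x1 x2, Y y1 -> Y y2 -> P y1 x1 -> P y2 x2 ->
    (dot (x1 - x2)%R (grad phi y1 - grad phi y2)%R)%:E
      <= bregman_sym phi y1 y2) ->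
  gap_convex phi f lambda.
Proof.
move=> domP mono.
have ex eta : Ys eta -> exists x, touch g x eta.
  move=> Ye; have Yy := conjugate_grad_intdom phi_dgf phi_legendre Ye.
  have : set_dom P (grad phis eta) by rewrite domP.
  move=> [x /(proxP phi_dgf f_proper lambda_gt0 lambda_lt x Yy)].
  by rewrite conjugate_gradK //; exists x.
have mono' y1 y2 x1 x2 eta1 eta2 : grad phi y1 = eta1 -> grad phi y2 = eta2 ->
    Y y1 -> Y y2 -> P y1 x1 -> P y2 x2 ->
    (dot (x1 - x2) (eta1 - eta2) <= dot (y1 - y2) (eta1 - eta2))%R.
  move=> <- <- Y1 Y2 P1 P2; rewrite -lee_fin -(bregman_symE Y1 Y2).
  exact: mono.
have {}mono eta1 eta2 x1 x2 : Ys eta1 -> Ys eta2 -> touch g x1 eta1 ->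
    touch g x2 eta2 -> (dot (x1 - x2) (eta1 - eta2) <=
     dot (grad phis eta1 - grad phis eta2) (eta1 - eta2))%R.
  move=> Ye1 Ye2 t1 t2.
  have Yy1 := conjugate_grad_intdom phi_dgf phi_legendre Ye1.
  have Yy2 := conjugate_grad_intdom phi_dgf phi_legendre Ye2.
  have gK1 := conjugate_gradK phi_dgf phi_legendre Ye1.
  have gK2 := conjugate_gradK phi_dgf phi_legendre Ye2.
  have P1 : P (grad phis eta1) x1 by apply/proxP => //; rewrite gK1.
  have P2 : P (grad phis eta2) x2 by apply/proxP => //; rewrite gK2.
  exact: mono' gK1 gK2 Yy1 Yy2 P1 P2.
have sub eta0 eta1 x0 : Ys eta0 -> Ys eta1 -> touch g x0 eta0 ->
    (psi eta0 + dot (grad phis eta0 - x0) (eta1 - eta0) <= psi eta1)%R.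
  move=> Y0 Y1 t0; apply/ler_addgt0Pr => e e0.
  set k := dot (grad phis eta0 - grad phis eta1) (eta1 - eta0).
  pose N := Num.trunc (`|k| / e)%R.
  pose s : R := (N.+1%:R^-1)%R; have s0 : (0 < s)%R by rewrite invr_gt0.
  have Yd j : (j <= N.+1)%N -> Ys (eta0 + j%:R *: (s *: (eta1 - eta0)))%R.
    move=> jN; have -> : (eta0 + j%:R *: (s *: (eta1 - eta0)) =
        (j%:R * s) *: eta1 + (1 - j%:R * s) *: eta0)%R.
      by rewrite scalerA scalerBr scalerBl scale1r addrCA addrA.
    apply: (@intdom_convex _ _ phis) => //; first exact: conjugate_convex.
    by rewrite mulr_ge0 ?(ltW s0) //= ler_pdivrMr // mul1r ler_nat.
  have := gap_steps ex mono t0 Yd.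
  have -> : (eta0 + N.+1%:R *: (s *: (eta1 - eta0)) = eta1)%R.
    by rewrite scalerA divff ?pnatr_eq0 // scale1r addrC subrK.
  rewrite (dotZr s (grad phis eta0 - x0)%R) (dotZr s (grad phis eta0 - _)%R) -/k.
  rewrite mulrA divff ?pnatr_eq0 // mul1r => h.
  suff : (- (s * k) <= e)%R by lra.
  rewrite /s -mulrN mulrC ler_pdivrMr //; apply: (le_trans (ler_norm _)).
  by rewrite normrN mulrC -ler_pdivrMr //; apply: ltW; exact: truncnS_gt.
split=> [eta /ex[x tx]|eta1 eta2 t Y1 Y2 /andP[t0 t1]].
  by rewrite (conjugate_touch tx).
have Ye : Ys (t *: eta1 + (1 - t) *: eta2)%R.
  by apply: intdom_convex; rewrite ?t0 //; exact: conjugate_convex.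
have [x tx] := ex _ Ye.
have h1 := sub _ _ _ Ye Y1 tx; have h2 := sub _ _ _ Ye Y2 tx.
have t1' : (0 <= 1 - t)%R by rewrite subr_ge0.
have := ler_wpM2l t0 h1; have := ler_wpM2l t1' h2.
set v := (_ - x)%R; rewrite !(dotBr, dotDr, dotZr); lra.
Qed.

End Nonexpansiveness.

Section Coercive.
Context {R : realType} {n : nat}.
Local Notation V := 'rV[R]_n.
Variables (phi f : V -> \bar R) (lambda : R).
Hypotheses (phi_dgf : dgf phi) (phi_legendre : legendre phi).
Hypotheses (f_proper : proper_on (edom phi) f) (f_lsc : lsc_on (edom phi) f).
Hypotheses (lambda_gt0 : (0 < lambda)%R).
Hypothesis lambda_lt : lambda%:E < prox_threshold phi f.
Implicit Types (x y z u v w eta : V).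
Local Notation phis := (conjugate phi).
Local Notation Y := (intdom phi).
Local Notation Ys := (intdom phis).
Local Notation g := (prox_objective phi f lambda).
Local Notation gs := (conjugate g).

Lemma one_coercive_intdom : one_coercive phi -> forall eta, Ys eta.
Proof.
move=> co; suff fin eta : phis eta < +oo.
  by move=> eta; apply: filterS filterT => z _; exact: fin.
have [_ _ _ [y Yy] _] := phi_dgf; have /touchP[r py hy] := grad_touch phi_dgf Yy.
have : ((n.+1%:R * `|eta|)%R%:E < limf_einf
    (fun x => phi x * (enorm x)^-1%:E) (@norm_infty R n))%E by rewrite co ltry.
rewrite limf_einfE => /ereal_sup_gt[_ [U NU <-] hU].
have [b [/= b0 bU]] := filter_ex (filterI (nbhs_pinfty_gt (num_real 0%R)) NU).
set a := (grad phi y - eta)%R.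
pose c := (`|r - dot (grad phi y) y| + n%:R * `|a| * b)%R.
have c0 : (0 <= c)%R by rewrite addr_ge0 // mulr_ge0 ?mulr_ge0 // ltW.
apply: (@le_lt_trans _ _ c%:E); last exact: ltry.
apply/conjugate_leP => x; have [xb|bx] := leP (enorm x) b.
  apply: le_trans (hy x); rewrite lee_fin dotBr.
  have := le_trans (ler_norm _) (dot_le (- a) x); rewrite normrN /a opprB dotBl.
  have : (n%:R * `|a| * `|x| <= n%:R * `|a| * b)%R.
    by rewrite ler_wpM2l ?mulr_ge0 // (le_trans (norm_le_enorm x)).
  have := ler_norm (- (r - dot (grad phi y) y))%R; rewrite normrN /c -/a.
  by lra.
have ex0 : (0 < enorm x)%R by exact: lt_trans bx.
have : (n.+1%:R * `|eta|)%R%:E < phi x * (enorm x)^-1%:E.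
  by apply: lt_le_trans hU _; apply: ereal_inf_lbound; exists x => //; exact: bU.
have := hy x; case: (phi x) => [p| |] // _; last by rewrite leey.
rewrite -EFinM lte_fin ltr_pdivlMr // lee_fin => h.
have := le_trans (ler_norm _) (dot_le eta x).
have : (n%:R * `|eta| * `|x| <= n.+1%:R * `|eta| * enorm x)%R.
  by rewrite ler_pM ?mulr_ge0 ?norm_le_enorm // ler_wpM2r // ler_nat.
lra.
Qed.

(** When every slope is available, the resolvents of the differentiable function
    [conjugate g] are resolvents of [g] as well, so that [g] equals its
    biconjugate although nothing was assumed on the convexity of [g]. *)
Lemma prox_objective_biconjugate_le w (c : R) : gap_convex phi f lambda ->
  (forall eta, Ys eta) ->
  (forall eta, (dot eta w - fine (gs eta) <= c)%R) -> g w <= c%:E.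
Proof.
move=> gapC Yall h; have [gfin _] := gapC.
have g_lsc := prox_objective_lsc phi_dgf f_proper f_lsc lambda_gt0 lambda_lt.
have [x0 gx0] := prox_objective_edom lambda phi_dgf f_proper.
have [v [b gvb]] :=
  prox_objective_affine_minorant phi_dgf f_proper lambda_gt0 lambda_lt.
have [r0 gr0] : exists r : R, g x0 = r%:E.
  by have := gvb x0; case: (g x0) gx0 => [r| |] // _ _; exists r.
have minor z : (dot x0 z + - r0)%R%:E <= gs z.
  by rewrite dotC; apply: conjugate_ge; rewrite gr0.
apply: (le_of_resolvents g_lsc gvb) => e e0.
have gs0 : gs 0%R < +oo by have := gfin _ (Yall 0%R); rewrite fin_numElt => /andP[].
have [eta teta] := resolvent_exists (e^-1 *: w)%R (@conjugate_lsc _ _ g)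
  (@conjugate_convex _ _ g) gs0 minor e0.
have tg := objective_grad_touch phi_dgf phi_legendre f_proper f_lsc lambda_gt0
  lambda_lt gapC (Yall eta).
have hg : has_grad (fine \o gs) eta (grad gs eta).
  have ue z : touch g z eta -> z = grad gs eta.
    move=> tz.
    exact: (objective_touch_unique phi_dgf phi_legendre gapC (Yall eta)).
  have Ge := conjugate_objective_intdom gapC (Yall eta).
  exact: (conjugate_has_grad g_lsc gx0 Ge tg ue).
have eqx : (e *: (e^-1 *: w - eta) = grad gs eta)%R.
  apply: has_grad_lower_unique hg _ => d d0.
  apply: filterS (@filterT _ (nbhs eta) _) => z _.
  have /touchP[s gss /(_ z)] := teta.
  rewrite -[X in _ <= X]fineK ?gfin // lee_fin /= gss /=.
  by have := mulr_ge0 (ltW d0) (normr_ge0 (z - eta)%R); lra.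
exists (grad gs eta), eta; split => //.
  by rewrite -eqx scalerBr scalerA divff ?gt_eqF // scale1r subrK.
have := h eta; rewrite (conjugate_touch tg) /= dotBr; lra.
Qed.

Lemma gap_convex_weakly_convex : one_coercive phi -> gap_convex phi f lambda ->
  B_weakly_convex phi (fun x => lambda%:E * f x).
Proof.
move=> /one_coercive_intdom Yall gapC; have [gfin _] := gapC.
have [_ _ phi_convex _ _] := phi_dgf.
apply/convex_onP => x y a b t Yx Yy ga gb t01.
have Yxy := intdom_convex phi_convex Yx Yy t01; split => //.
rewrite -prox_objective_in; last exact: intdom_edom.
move: ga gb; rewrite -!prox_objective_in; try exact: intdom_edom.
move=> ga gb; apply: prox_objective_biconjugate_le => // eta.
have /andP[t0 t1] := t01; have t1' : (0 <= 1 - t)%R by rewrite subr_ge0.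
have := conjugate_ge eta ga; have := conjugate_ge eta gb.
rewrite -[gs eta]fineK ?gfin // !lee_fin => /(ler_wpM2l t1') h1.
by move=> /(ler_wpM2l t0); rewrite !(dotDr, dotZr); lra.
Qed.

End Coercive.

(** * The equivalences *)

Theorem theorem4p18 (R : realType) (n : nat) (phi f : 'rV[R]_n -> \bar R)
    (phi_dgf : dgf phi) (phi_legendre : legendre phi)
    (f_proper : proper_on (edom phi) f) (f_lsc : lsc_on (edom phi) f)
    (f_prox_bounded : prox_bounded phi f)
    (lambda : R) (lambda_gt0 : (0 < lambda)%R)
    (lambda_lt : lambda%:E < prox_threshold phi f) :
  let phis := conjugate phi in
  let Y := intdom phi in
  let Ys := intdom phis in
  let P := prox phi lambda f in
  let h := fun eta => env phi lambda f (grad phis eta) in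
  let ftilde := patch (fun=> +oo) (edom phi) f in
  let stA := proper_on Ys h /\ convex_on Ys h in
  let stB := convex_on Ys (fun eta => lambda%:E * h eta) /\
           B_smooth phis (fun eta => lambda%:E * h eta) in
  let stC := B_smooth phis (conjugate (fun x => lambda%:E * ftilde x + phi x)) in
  let stD := convex_on Ys h /\ C1_on Ys h in
  let stE := exists2 T, single_valued_on Y P T & a_firmly_nonexpansive phi T in
  let stF := set_dom P = Y /\
           forall y1 y2 x1 x2, Y y1 -> Y y2 -> P y1 x1 -> P y2 x2 ->
             (dot (x1 - x2)%R (grad phi y1 - grad phi y2)%R)%:E
             <= bregman_sym phi y1 y2 in
  [/\ [<-> stA; stB; stC; stD],
      [\/ stA, stB, stC | stD] ->
        [/\ exists2 T, single_valued_on Y P T &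
              forall eta, Ys eta ->
                grad h eta =
                (lambda^-1 *: (grad phis eta - T (grad phis eta)))%R,
            stE & stF] &
      one_coercive phi ->
        [<-> stA; stB; stC; stD; stE; stF] /\
        (stA -> B_weakly_convex phi (fun x => lambda%:E * f x))].
Proof.
move=> phis Y Ys P h ftilde stA stB stC stD stE stF.
have AP : stA <-> gap_convex phi f lambda by exact: proper_convex_envP.
have BP : stB <-> gap_convex phi f lambda by exact: B_smooth_envP.
have CP : stC <-> gap_convex phi f lambda by exact: B_smooth_conjugateP.
have DP : stD <-> gap_convex phi f lambda.
  split=> [|gapC]; first exact: C1_env_gap_convex.
  by split; [have [] := AP.2 gapC|exact: env_C1].
have ET : gap_convex phi f lambda -> stE.
  move=> gapC; exists (prox_map phi f lambda); first exact: prox_single_valued.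
  exact: prox_map_firmly_nonexpansive.
have EF : stE -> stF.
  by move=> [S PS firm]; exact: firmly_nonexpansive_monotone PS firm.
have FP : stF -> gap_convex phi f lambda.
  by move=> [domP mono]; exact: monotone_gap_convex.
split=> [|ABCD|coercive].
- by tfae=> [/AP/BP|/BP/CP|/CP/DP|/DP/AP].
- have gapC : gap_convex phi f lambda by case: ABCD => [/AP|/BP|/CP|/DP].
  split; [|exact: ET|exact/EF/ET].
  exists (prox_map phi f lambda); first exact: prox_single_valued.
  by move=> eta Yeta; exact: env_grad.
- split; first by tfae=> [/AP/BP|/BP/CP|/CP/DP|/DP/ET|/EF|/FP/AP].
  by move=> /AP gapC; exact: gap_convex_weakly_convex.
Qed.
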